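(* Let $\Phi:\mathbb{R}^2\to\mathbb{R}^2$ be a smooth mapping, let $\Sigma=\{x\in\mathbb{R}^2:\Phi(x)=x\}$ be its fixed point set, and let $S:\mathbb{R}^2\to\mathbb{R}$ be defined by $S(x)=\sigma(\Phi(x),x)$, where $\sigma(x,x')=\tfrac12|x-x'|^2$. Assume: ($\Phi$.1) $\Sigma$ is a one-point set, $\Sigma=\{\xi_0\}$. ($\Phi$.2) There exist constants $p>0$, $R>0$, $C>0$ such that for any $x\in\mathbb{R}^2$, if $\sigma(x,0)>\frac{R^2}{2}$, then $S(x)\geqslant C[\sigma(x,0)]^p$. ($\Phi$.3) $\xi_0$ is a non-degenerate critical point of the function $S$. Then there exists the asymptotic expansion as $t\to0^+$ $$\Theta_\Phi(t)\sim\sum_{k=0}^\infty t^kA_k,$$ where scalars $A_k$ depend polynomially on derivatives of the function $S$ and the inverse of its Hessian matrix, evaluated at $\xi_0$.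
   Context: The plane $\mathbb{R}^2$ carries the Euclidean metric and Cartesian coordinates, with heat kernel $U(t;x,x')=(4\pi t)^{-1}\exp\left(-\frac{\sigma(x,x')}{2t}\right)$. The deformed heat trace is $$\Theta_\Phi(t)=\int_{\mathbb{R}^2}dx\,U(t;\Phi(x),x)=(4\pi t)^{-1}\int_{\mathbb{R}^2}dx\,\exp\left(-\frac{1}{2t}S(x)\right).$$ A point $\xi_0$ is a non-degenerate critical point of $S$ if $\nabla S(\xi_0)=0$ and the Hessian matrix $(\partial_i\partial_jS)(\xi_0)$ is strictly positive or strictly negative definite. The asymptotic expansion $F(t)\sim\sum_kt^kA_k$ means that for every $K$, $F(t)-\sum_{k=0}^Kt^kA_k=o(t^K)$ as $t\to0^+$.
   Formalization: The A_k are shown to be (det H)^(-1/2) times a universal polynomial in derivatives of S and entries of H^(-1) at ξ_0, H the Hessian of S; without this factor the claim fails already for A_0 = (det H)^(-1/2). *)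

(* Defs.v *)
From HB Require Import structures.
From mathcomp Require Import all_boot all_order all_algebra.
From mathcomp Require Import all_classical all_reals all_analysis.
(* Not imported: the notations of mpoly clash with those of mathcomp-analysis. *)
From mathcomp Require mpoly.

Set Implicit Arguments.
Unset Strict Implicit.
Unset Printing Implicit Defensive.
Import Order.TTheory GRing.Theory Num.Theory.
Import numFieldNormedType.Exports.
Local Open Scope classical_set_scope.
Local Open Scope ring_scope.

(* The library norm on [R * R] is the sup norm; it is used only through the
   topology.  The Euclidean distance enters through [sigma]. *)
Notation plane R := (R * R)%type.

Section HeatKernel.
Context {R : realType}.
Implicit Types (x y : plane R) (Phi : plane R -> plane R) (t : R).

Definition sigma x y : R :=
  2^-1 * ((x.1 - y.1) ^+ 2 + (x.2 - y.2) ^+ 2).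

Definition heat_kernel t x y : R := (4 * pi * t)^-1 * expR (- (sigma x y / (2 * t))).

Local Notation area := (@lebesgue_measure R \x @lebesgue_measure R)%E.

Definition deformed_heat_trace Phi t : R :=
  \int[area]_x heat_kernel t (Phi x) x.

(* [Rintegral] returns a default value on non-integrable functions, so the
   existence of the integral is recorded separately. *)
Definition deformed_heat_trace_exists Phi t : Prop :=
  area.-integrable setT
    (fun x => (heat_kernel t (Phi x) x)%:E).

Definition fixed_points Phi : set (plane R) := [set x | Phi x = x].

Definition displacement Phi x : R := sigma (Phi x) x.

End HeatKernel.

Section Derivatives.
Context {R : realType}.
Implicit Types (f : plane R -> R) (x : plane R).

Definition basis_vec (i : 'I_2) : plane R := ((i == 0)%:R, (i == 1)%:R).

Definition partial (i : 'I_2) f : plane R -> R := fun x => 'D_(basis_vec i) f x.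

Definition iter_partial (s : seq 'I_2) f : plane R -> R := foldr partial f s.

Definition smooth f : Prop := forall s : seq 'I_2,
  continuous (iter_partial s f) /\
  forall (i : 'I_2) x, derivable (iter_partial s f) x (basis_vec i).

Definition smooth_map (Phi : plane R -> plane R) : Prop :=
  smooth (fun x => (Phi x).1) /\ smooth (fun x => (Phi x).2).

Definition hessian f x : 'M[R]_2 := \matrix_(i, j) partial i (partial j f) x.

Definition posdef (H : 'M[R]_2) : Prop :=
  forall v : 'cV[R]_2, v != 0 -> 0 < (v^T *m H *m v) ord0 ord0.

Definition negdef (H : 'M[R]_2) : Prop :=
  forall v : 'cV[R]_2, v != 0 -> (v^T *m H *m v) ord0 ord0 < 0.

Definition nondegenerate_critical_point f x : Prop :=
  (forall i : 'I_2, partial i f x = 0) /\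
  (posdef (hessian f x) \/ negdef (hessian f x)).

End Derivatives.

Section Expansion.
Context {R : realType}.

Definition asymptotic_expansion (F : R -> R) (A : nat -> R) : Prop :=
  forall K : nat,
    (fun t : R => F t - \sum_(k < K.+1) t ^+ k * A k) =o_ (0^'+)
    (fun t : R => t ^+ K).

(* Names of the quantities on which a coefficient may depend: [inl (a, b)]
   is d_1^a d_2^b f (x) with a, b < n, and [inr (i, j)] is the (i, j) entry of
   the inverse of the Hessian matrix of f at x. *)
Definition jet_var (n : nat) : finType := ('I_n * 'I_n + 'I_2 * 'I_2)%type.

Definition jet_value (f : plane R -> R) (x : plane R) n (v : jet_var n) : R :=
  match v with
  | inl (a, b) => iter_partial (nseq a 0 ++ nseq b 1) f x
  | inr (i, j) => invmx (hessian f x) i j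
  end.

Definition jet_poly (n : nat) : Type := mpoly.mpoly #|jet_var n| R.

Definition jet_eval n (P : jet_poly n) (f : plane R -> R) (x : plane R) : R :=
  mpoly.meval (fun i => jet_value f x (enum_val i)) P.

(* The factor det(Hess)^(-1/2) of Laplace's method, common to all coefficients,
   is not itself a polynomial in the jet of f and the inverse Hessian. *)
Definition laplace_coef n (P : jet_poly n) (f : plane R -> R) (x : plane R) : R :=
  Num.sqrt (\det (invmx (hessian f x))) * jet_eval P f x.

End Expansion.

(* Main.v *)
(* Laplace's method. Put h = x - xi0, let q be half the Hessian form of S at
   xi0 and T the Taylor polynomial of S at xi0 with its terms of degree < 3
   removed. Near xi0 one replaces exp (- S / 2t) by
   exp (- q / 2t) * sum_(m < M) (- T / 2t)^m / m!; after the scaling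
   h = sqrt t * y the error is of higher order in t, times a Gaussian. Away
   from xi0 both sides are exponentially small. What remains are Gaussian
   moments; integration by parts expresses them recursively through the
   inverse Hessian, and each monomial h^a t^-m of the truncated exponential
   contributes a nonnegative integer power of t, or 0 by parity. A truncation
   order K only gives the coefficients up to t^K; that they do not depend on K
   follows from the uniqueness of asymptotic expansions. *)
Require Import Defs.
From mathcomp Require Import all_boot all_order all_algebra.
From mathcomp Require Import all_classical all_reals all_analysis.
From mathcomp Require Import measurable_realfun ring.
From mathcomp Require mpoly.
Import -(notations) mpoly.
Import Order.TTheory GRing.Theory Num.Theory.
Import numFieldNormedType.Exports.
Local Open Scope classical_set_scope.
Local Open Scope ring_scope.

Set Implicit Arguments.
Unset Strict Implicit.
Unset Printing Implicit Defensive.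

(** * Integration on the plane *)

Section PlaneMeasurability.
Context {R : realType}.

Lemma open_plane_measurable (U : set (plane R)) : open U -> measurable U.
Proof.
move=> oU.
pose B (p : rat * rat * nat) : set (plane R) :=
  ball (ratr p.1.1 : R) p.2.+1%:R^-1 `*` ball (ratr p.1.2 : R) p.2.+1%:R^-1.
have -> : U = \bigcup_p (if `[< B p `<=` U >] then B p else set0).
  apply/seteqP; split => [x Ux | x [p _]]; last by case: asboolP => [BU /BU|_ []].
  have /nbhs_ballP[e /= e0 xeU] : nbhs x U by apply: open_nbhs_nbhs.
  have [n ne] : exists n : nat, n.+1%:R^-1 < e / 2 :> R.
    have e20 : 0 < e / 2 by rewrite divr_gt0.
    have := near_infty_natSinv_lt (PosNum e20).
    by case=> m _ /(_ m (leqnn m)) /=; exists m.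
  have bal (y : R) : exists q : rat, ball y n.+1%:R^-1 (ratr q : R).
    have [||z [bz [q _ qz]]] := @dense_rat R (ball y n.+1%:R^-1).
    - by exists y; apply: ballxx; rewrite invr_gt0.
    - exact: ball_open.
    - by exists q; rewrite qz.
  have [q1 xq1] := bal x.1; have [q2 xq2] := bal x.2.
  exists (q1, q2, n) => //; case: asboolP.
    by move=> _; split => /=; apply: ball_sym.
  case=> -[y1 y2] [/= y1q y2q]; apply: xeU.
  split; (apply: (@le_ball _ _ _ (n.+1%:R^-1 + n.+1%:R^-1)); first by rewrite [leRHS]splitr ltW// ltrD);
    by [apply: ball_triangle y1q|apply: ball_triangle y2q].
apply: countable_bigcupT_measurable => // p; case: asboolP => // _.
by apply: measurableX; exact: measurable_ball.
Qed.

Lemma continuous_plane_measurable (f : plane R -> R) :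
  continuous f -> measurable_fun setT f.
Proof.
move=> /continuousP cf; apply: (measurability _ (RGenOpens.measurableE R)).
move=> _ [_ [a [b ->] <-]]; rewrite setTI; apply: open_plane_measurable.
exact/cf/interval_open.
Qed.

End PlaneMeasurability.

Section IntegralOfDerivative.
Context {R : realType}.
Local Notation mu := (@lebesgue_measure R).

Lemma integral_derive_eq0 (F f : R -> R) :
    (forall x : R, is_derive x 1 F (f x)) -> continuous f ->
    mu.-integrable setT (EFin \o f) ->
    F x @[x --> +oo] --> 0 -> F x @[x --> -oo] --> 0 ->
  (\int[mu]_x (f x)%:E = 0)%E.
Proof.
move=> dF cf intf Fy FNy.
have cF : continuous F.
  move=> x; apply: differentiable_continuous; apply/derivable1_diffP.
  by have [] := dF x.
pose I (n : nat) : set R := `[(- n.+1%:R : R), n.+1%:R]%classic.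
have mI n : measurable (I n) by exact: measurable_itv.
have [_ _] : [/\ mu.-integrable setT (EFin \o f),
    [sequence \int[mu]_x `|((f \_ (I n)) x)%:E - (f x)%:E|]_n @ \oo --> 0 &
    [sequence \int[mu]_x ((f \_ (I n)) x)%:E]_n @ \oo -->
      \int[mu]_x (f x)%:E]%E.
  apply: (@dominated_convergence _ _ R mu setT measurableT _ _
    (fun x => `|(f x)%:E|)%E).
  - move=> n; apply/measurable_EFinP; apply/(measurable_restrictT _ _).1; first exact: mI.
    by apply: measurable_funTS; exact: continuous_measurable_fun.
  - exact: (measurable_int mu).
  - apply: aeW => x _; apply: cvg_near_cst.
    near=> n; rewrite patchE ifT// inE /I /= in_itv /=.
    have : `|x| <= n.+1%:R.
      rewrite (le_trans _ (_ : n%:R <= _)) ?ler_nat//.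
      by near: n; exact: nbhs_infty_ger.
    by rewrite ler_norml.
  - exact: integrable_abse.
  - apply: aeW => x n _; rewrite patchE; case: ifP => // _.
    by rewrite abse0.
suff -> : [sequence \int[mu]_x ((f \_ (I n)) x)%:E]_n%E =
    (fun n : nat => (F n.+1%:R - F (- n.+1%:R))%:E).
  move=> c1; have c2 : ((F n.+1%:R - F (- n.+1%:R))%:E)%E @[n --> \oo] --> 0%E.
    apply: cvg_EFin; first exact: nearW.
    rewrite -[0 : R](subr0 0); apply: cvgB.
      apply: (cvg_comp _ _ _ Fy); apply/cvgryPge => A; near=> n.
      rewrite (le_trans _ (_ : n%:R <= _)) ?ler_nat//.
      by near: n; exact: nbhs_infty_ger.
    apply: (cvg_comp _ _ _ FNy); apply/cvgrNyPle => A; near=> n.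
    rewrite lerNl (le_trans _ (_ : n%:R <= _)) ?ler_nat//.
    by near: n; exact: nbhs_infty_ger.
  exact: (cvg_unique _ c1 c2).
apply/funext => n /=.
transitivity (\int[mu]_(x in I n) (f x)%:E)%E.
  rewrite [RHS]integral_mkcond; apply: eq_integral => x _ /=.
  by rewrite !patchE; case: ifP.
rewrite (@continuous_FTC2 _ f F) ?EFinB//.
- by rewrite -subr_gt0 opprK.
- exact: continuous_subspaceT.
- split=> [x _||]; first by have [] := dF x.
    exact/cvg_at_right_filter/cF.
  exact/cvg_at_left_filter/cF.
- by move=> x _; rewrite derive1E; have [] := dF x.
Unshelve. all: by end_near.
Qed.

End IntegralOfDerivative.

Section PowerDerivative.
Context {R : realType}.

Lemma is_derive_subX n (m s : R) :
  is_derive s 1 (fun s : R => (s - m) ^+ n) (n%:R * (s - m) ^+ n.-1).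
Proof.
have dh : is_derive s 1 (fun s : R => s - m) 1.
  have := @is_deriveB R R R id (cst m) s 1 1 0 (is_derive_id _ _) (is_derive_cst _ _ _).
  by rewrite subr0.
have := @is_deriveX R R _ n s 1 1 dh.
by rewrite exprfctE /GRing.scale /= mulr1.
Qed.

End PowerDerivative.

Section GaussianBounds.
Context {R : realType}.
Implicit Types (x xi : plane R).

Definition sqdist xi x : R := (x.1 - xi.1) ^+ 2 + (x.2 - xi.2) ^+ 2.

Definition dist xi x : R := Num.sqrt (sqdist xi x).

Definition monomial (a b : nat) xi x : R := (x.1 - xi.1) ^+ a * (x.2 - xi.2) ^+ b.

Definition quad (A B D : R) xi x : R :=
  A * (x.1 - xi.1) ^+ 2 + 2 * B * (x.1 - xi.1) * (x.2 - xi.2) +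
  D * (x.2 - xi.2) ^+ 2.

Lemma sqdist_ge0 xi x : 0 <= sqdist xi x.
Proof. by rewrite addr_ge0// sqr_ge0. Qed.

Lemma dist_ge0 xi x : 0 <= dist xi x.
Proof. exact: sqrtr_ge0. Qed.

Lemma dist_sqr xi x : dist xi x ^+ 2 = sqdist xi x.
Proof. by rewrite sqr_sqrtr// sqdist_ge0. Qed.

Lemma le_dist1 xi x : `|x.1 - xi.1| <= dist xi x.
Proof.
by rewrite -(sqrtr_sqr (x.1 - xi.1)) ler_sqrt ?sqdist_ge0// lerDl sqr_ge0.
Qed.

Lemma le_dist2 xi x : `|x.2 - xi.2| <= dist xi x.
Proof.
by rewrite -(sqrtr_sqr (x.2 - xi.2)) ler_sqrt ?sqdist_ge0// lerDr sqr_ge0.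
Qed.

Lemma monomial_le a b xi x : `|monomial a b xi x| <= dist xi x ^+ (a + b).
Proof.
rewrite normrM !normrX exprD ler_pM ?exprn_ge0//.
  by rewrite lerXn2r ?nnegrE ?dist_ge0 ?le_dist1.
by rewrite lerXn2r ?nnegrE ?dist_ge0 ?le_dist2.
Qed.

Lemma pow_gauss_bounded n (c : R) : 0 < c ->
  exists2 C : R, 0 < C & forall y : R, 0 <= y -> y ^+ n * expR (- (c * y ^+ 2)) <= C.
Proof.
move=> c0; pose m := n.+1; pose C : R := 1 + m`!%:R / c ^+ m.
have C0 : 0 < C by rewrite addr_gt0// divr_gt0 ?ltr0n ?fact_gt0// exprn_gt0.
exists C => // y y0.
have cy0 : 0 <= c * y ^+ 2 by rewrite mulr_ge0 ?exprn_ge0// ltW.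
have h1 : y ^+ n <= 1 + (y ^+ 2) ^+ m.
  have [y1|y1] := leP y 1.
    by rewrite (le_trans (exprn_ile1 _ y0 y1))// lerDl -exprM exprn_ge0.
  rewrite (@le_trans _ _ ((y ^+ 2) ^+ m))//; last by rewrite lerDr.
  by rewrite -exprM ler_weXn2l ?ltW// /m mul2n -addnn addSn addnS ltnW// ltnS ltnW// ltnS leq_addr.
have h2 : 1 + (y ^+ 2) ^+ m <= C * expR (c * y ^+ 2).
  have e1 : 1 <= expR (c * y ^+ 2) by rewrite -expR0 ler_expR.
  have e2 : (c * y ^+ 2) ^+ m / m`!%:R <= expR (c * y ^+ 2).
    by apply: le_trans (expR_ge1Dxn n cy0); rewrite lerDr.
  have k0 : 0 <= m`!%:R / c ^+ m by rewrite divr_ge0// exprn_ge0// ltW.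
  rewrite mulrDl mul1r lerD// (le_trans _ (ler_wpM2l k0 e2))//.
  rewrite [(c * _) ^+ m]exprMn -!mulrA mulKf ?expf_neq0 ?gt_eqF//.
  by rewrite mulrC divfK// gt_eqF// ltr0n fact_gt0.
by rewrite expRN ler_pdivrMr ?expR_gt0// (le_trans h1).
Qed.

Definition gauss_dominated xi (f : plane R -> R) := exists C c : R,
  [/\ 0 < C, 0 < c & forall x, `|f x| <= C * expR (- (c * sqdist xi x))].

Lemma gauss_dominatedM xi (k : R) f :
  gauss_dominated xi f -> gauss_dominated xi (fun x => k * f x).
Proof.
move=> [C [c [C0 c0 fC]]]; exists ((`|k| + 1) * C), c; split => //.
  by rewrite mulr_gt0// ltr_wpDl.
move=> x; rewrite normrM -mulrA ler_pM// ?(le_trans _ (fC x))//.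
by rewrite lerDl.
Qed.

Lemma gauss_dominatedD xi f g : gauss_dominated xi f -> gauss_dominated xi g ->
  gauss_dominated xi (fun x => f x + g x).
Proof.
move=> [C [c [C0 c0 fC]]] [C' [c' [C'0 c'0 gC]]].
exists (C + C'), (Num.min c c'); split; first exact: addr_gt0.
  by rewrite lt_min c0.
move=> x; rewrite (le_trans (ler_normD _ _))// mulrDl lerD//.
  rewrite (le_trans (fC x))// ler_pM2l// ler_expR lerN2 ler_wpM2r ?sqdist_ge0//.
  by rewrite ge_min lexx.
rewrite (le_trans (gC x))// ler_pM2l// ler_expR lerN2 ler_wpM2r ?sqdist_ge0//.
by rewrite ge_min lexx orbT.
Qed.

Lemma quad_ge (A B D : R) xi x : 0 < A -> 0 < A * D - B ^+ 2 ->
  (A * D - B ^+ 2) / (A + D) * sqdist xi x <= quad A B D xi x.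
Proof.
move=> A0 dt.
have D0 : 0 < D.
  by rewrite -(pmulr_rgt0 _ A0) (lt_le_trans dt)// lerBlDr lerDl sqr_ge0.
have AD : 0 < A + D by rewrite addr_gt0.
rewrite mulrAC ler_pdivrMr// -subr_ge0 /quad /sqdist.
set h := x.1 - xi.1; set k := x.2 - xi.2.
suff -> : (A * h ^+ 2 + 2 * B * h * k + D * k ^+ 2) * (A + D) -
   (A * D - B ^+ 2) * (h ^+ 2 + k ^+ 2) = (A * h + B * k) ^+ 2 + (B * h + D * k) ^+ 2.
  by rewrite addr_ge0// sqr_ge0.
by ring.
Qed.

Lemma monomial_gauss_dominated (A B D : R) xi a b :
    0 < A -> 0 < A * D - B ^+ 2 ->
  gauss_dominated xi (fun x => monomial a b xi x * expR (- quad A B D xi x)).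
Proof.
move=> A0 dt; have AD : 0 < A + D.
  rewrite addr_gt0// -(pmulr_rgt0 _ A0) (lt_le_trans dt)//.
  by rewrite lerBlDr lerDl sqr_ge0.
pose k := (A * D - B ^+ 2) / (A + D) / 2.
have k0 : 0 < k by rewrite !divr_gt0.
have [C C0 hC] := pow_gauss_bounded (a + b) k0.
exists C, k; split => // x.
rewrite normrM (ger0_norm (expR_ge0 _)).
rewrite (le_trans (ler_wpM2r (expR_ge0 _) (monomial_le _ _ _ _)))//.
apply: (@le_trans _ _ (dist xi x ^+ (a + b) *
    (expR (- (k * dist xi x ^+ 2)) * expR (- (k * sqdist xi x))))).
  rewrite ler_wpM2l ?exprn_ge0 ?dist_ge0// -expRD ler_expR dist_sqr -opprD.
  rewrite lerN2 (le_trans _ (quad_ge _ _ A0 dt))// -mulrDl.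
  by rewrite /k -splitr.
by rewrite mulrA ler_wpM2r ?expR_ge0// hC// dist_ge0.
Qed.

End GaussianBounds.

Section GaussianIntegrals.
Context {R : realType}.
Implicit Types (xi : plane R).
Local Notation mu := (@lebesgue_measure R).
Local Notation area := (@lebesgue_measure R \x @lebesgue_measure R)%E.

Lemma gauss_normal_pdf (c m : R) : 0 < c ->
  exists s : R, (fun x : R => expR (- (c * (x - m) ^+ 2))) =
    (fun x => Num.sqrt (pi / c) * normal_pdf m s x).
Proof.
move=> c0; pose s : R := Num.sqrt (2 * c)^-1.
have s0 : s != 0 by rewrite gt_eqF// sqrtr_gt0 invr_gt0 mulr_gt0.
have s2 : s ^+ 2 = (2 * c)^-1 by rewrite sqr_sqrtr// invr_ge0 mulr_ge0// ltW.
have pk : normal_peak s = (Num.sqrt (pi / c))^-1.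
  rewrite /normal_peak s2 -mulr_natr; congr (Num.sqrt _)^-1.
  by field; rewrite gt_eqF.
exists s; apply/funext => x.
rewrite normal_pdfE// pk [RHS]mulVKf; last by rewrite gt_eqF// sqrtr_gt0 divr_gt0// pi_gt0.
rewrite /normal_fun s2 -mulr_natr; congr expR.
by field; rewrite gt_eqF.
Qed.

Lemma integral_gauss (c m : R) : 0 < c ->
  (\int[mu]_x (expR (- (c * (x - m) ^+ 2)))%:E = (Num.sqrt (pi / c))%:E)%E.
Proof.
move=> c0; have [s E] := gauss_normal_pdf m c0.
under eq_integral do rewrite [expR _](congr1 (fun f => f _) E) EFinM.
rewrite integralZl//=; last exact: integrable_normal_pdf.
by rewrite integral_normal_pdf mule1.
Qed.

Lemma integrable_gauss (c m : R) : 0 < c ->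
  mu.-integrable setT (fun x => (expR (- (c * (x - m) ^+ 2)))%:E).
Proof.
move=> c0; have [s E] := gauss_normal_pdf m c0.
have -> : (fun x : R => (expR (- (c * (x - m) ^+ 2)))%:E) =
    (fun x => (Num.sqrt (pi / c))%:E * (normal_pdf m s x)%:E)%E.
  by apply/funext => x; rewrite -EFinM -[in RHS](congr1 (fun f => f x) E).
by apply: integrableZl => //; exact: integrable_normal_pdf.
Qed.

Lemma continuous_coord1 xi : continuous (fun x : plane R => x.1 - xi.1).
Proof. by move=> x; apply: cvgB; [exact: cvg_fst|exact: cvg_cst]. Qed.

Lemma continuous_coord2 xi : continuous (fun x : plane R => x.2 - xi.2).
Proof. by move=> x; apply: cvgB; [exact: cvg_snd|exact: cvg_cst]. Qed.

Lemma continuous_monomial a b xi : continuous (monomial a b xi).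
Proof.
move=> x; apply: cvgM.
  exact: (continuous_comp (@continuous_coord1 xi x) (@exprn_continuous R a _)).
exact: (continuous_comp (@continuous_coord2 xi x) (@exprn_continuous R b _)).
Qed.

Lemma quadE (A B D : R) xi x : quad A B D xi x =
  A * monomial 2 0 xi x + 2 * B * monomial 1 1 xi x + D * monomial 0 2 xi x.
Proof. by rewrite /quad /monomial !expr0 !expr1; ring. Qed.

Lemma continuous_quad (A B D : R) xi : continuous (quad A B D xi).
Proof.
have -> : quad A B D xi = (fun x : plane R => A * monomial 2 0 xi x +
    2 * B * monomial 1 1 xi x + D * monomial 0 2 xi x).
  by apply/funext => x; exact: quadE.
by move=> x; do 2 ?apply: cvgD; apply: cvgM;
  by [exact: cvg_cst|exact: continuous_monomial].
Qed.

Lemma continuous_gauss_weight (A B D : R) xi :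
  continuous (fun x : plane R => expR (- quad A B D xi x)).
Proof.
move=> x; apply: continuous_comp; last exact: continuous_expR.
by apply: cvgN; exact: continuous_quad.
Qed.

Lemma integral_gauss_weight (A B D : R) xi : 0 < A -> 0 < A * D - B ^+ 2 ->
  (\int[area]_x (expR (- quad A B D xi x))%:E =
   (pi / Num.sqrt (A * D - B ^+ 2))%:E)%E.
Proof.
move=> A0 dt; have D0 : 0 < D.
  by rewrite -(pmulr_rgt0 _ A0) (lt_le_trans dt)// lerBlDr lerDl sqr_ge0.
rewrite fubini_tonelli1; last 2 first.
- apply/measurable_EFinP; apply: continuous_plane_measurable.
  exact: continuous_gauss_weight.
- by move=> x; rewrite lee_fin expR_ge0.
have dD : 0 < (A * D - B ^+ 2) / D by rewrite divr_gt0.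
transitivity (\int[mu]_x ((Num.sqrt (pi / D))%:E *
    (expR (- ((A * D - B ^+ 2) / D * (x - xi.1) ^+ 2)))%:E))%E.
  apply: eq_integral => x1 _; rewrite /fubini_F /=.
  rewrite -(integral_gauss (xi.2 - B / D * (x1 - xi.1)) D0).
  rewrite -integralZr//=; last exact: integrable_gauss.
  apply: eq_integral => x2 _; rewrite -EFinM -expRD; congr (expR _)%:E.
  by rewrite /quad /=; field; rewrite gt_eqF.
rewrite integralZl//=; last exact: integrable_gauss.
rewrite integral_gauss// -EFinM -sqrtrM ?divr_ge0 ?pi_ge0 ?ltW//.
have -> : pi / D * (pi / ((A * D - B ^+ 2) / D)) = pi ^+ 2 / (A * D - B ^+ 2).
  by field; rewrite !gt_eqF.
by rewrite sqrtrM ?sqr_ge0// sqrtr_sqr ger0_norm ?pi_ge0// sqrtrV// ltW.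
Qed.

Lemma gauss_dominated_integrable xi (f : plane R -> R) :
  continuous f -> gauss_dominated xi f -> area.-integrable setT (EFin \o f).
Proof.
move=> cf [C [c [C0 c0 fC]]].
have qE x : c * sqdist xi x = quad c 0 c xi x.
  by rewrite /quad /sqdist; ring.
have dt : 0 < c * c - 0 ^+ 2 by rewrite expr0n subr0 mulr_gt0.
apply: (@le_integrable _ _ R area setT measurableT (EFin \o f)
  (fun x : plane R => C%:E * (expR (- quad c 0 c xi x))%:E)%E) => //.
- by apply/measurable_EFinP; exact: continuous_plane_measurable.
- by move=> x _; rewrite -EFinM -qE lee_fin (le_trans (fC x))// ler_norm.
apply: integrableZl => //; apply/integrableP; split.
  apply/measurable_EFinP; apply: continuous_plane_measurable.
  exact: continuous_gauss_weight.
under eq_integral do rewrite /= ger0_norm ?expR_ge0//.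
by rewrite integral_gauss_weight// ltry.
Qed.

Lemma integral_derive_gauss_eq0 (F f : R -> R) (m C c : R) : 0 < c ->
    (forall x : R, is_derive x 1 F (f x)) -> continuous f ->
    (forall x, `|F x| <= C * expR (- (c * (x - m) ^+ 2))) ->
    (forall x, `|f x| <= C * expR (- (c * (x - m) ^+ 2))) ->
  (\int[mu]_x (f x)%:E = 0)%E.
Proof.
move=> c0 dF cf FC fC.
have C0 : 0 <= C.
  have := le_trans (normr_ge0 _) (FC m).
  by rewrite pmulr_lge0// expR_gt0.
have [K K0 hK] := pow_gauss_bounded 1 c0.
have FK (e : R) : 0 < e -> forall x, C * K / e < `|x - m| -> `|F x| <= e.
  move=> e0 x xe; have xm0 : 0 < `|x - m|.
    by rewrite (le_lt_trans _ xe)// divr_ge0 ?mulr_ge0// ltW.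
  rewrite -(ler_pM2r xm0) (@le_trans _ _ (C * K))//; last first.
    by rewrite [leRHS]mulrC -ler_pdivrMr// ltW.
  rewrite (le_trans (ler_wpM2r _ (FC x)))// -mulrA ler_wpM2l// mulrC.
  by have := hK _ (normr_ge0 (x - m)); rewrite expr1 real_normK ?num_real.
apply: (@integral_derive_eq0 _ F) => //.
- apply: (@le_integrable _ _ R mu setT measurableT (EFin \o f)
    (fun x : R => C%:E * (expR (- (c * (x - m) ^+ 2)))%:E)%E) => //.
  + by apply/measurable_EFinP; exact: continuous_measurable_fun.
  + by move=> x _; rewrite -EFinM lee_fin (le_trans (fC x))// ler_norm.
  + by apply: integrableZl => //; exact: integrable_gauss.
- apply/cvgr0Pnorm_le => e e0; near=> x; apply: FK => //.
  rewrite (lt_le_trans _ (ler_norm _))// ltrBrDr.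
  by near: x; apply: nbhs_pinfty_gt; exact: num_real.
- apply/cvgr0Pnorm_le => e e0; near=> x; apply: FK => //.
  rewrite distrC (lt_le_trans _ (ler_norm _))// ltrBrDl -ltrBrDr.
  by near: x; apply: nbhs_ninfty_lt; exact: num_real.
Unshelve. all: by end_near.
Qed.

End GaussianIntegrals.

(** * Gaussian moments *)

Section GaussianMoments.
Context {R : realType}.
Implicit Types (xi : plane R).
Local Notation mu := (@lebesgue_measure R).
Local Notation area := (@lebesgue_measure R \x @lebesgue_measure R)%E.

Lemma gauss_dominated_slices xi (F f : plane R -> R) :
    gauss_dominated xi F -> gauss_dominated xi f ->
  exists C c : R, 0 < c /\ forall x1 x2 : R,
    [/\ `|F (x1, x2)| <= C * expR (- (c * (x1 - xi.1) ^+ 2)),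
        `|f (x1, x2)| <= C * expR (- (c * (x1 - xi.1) ^+ 2)),
        `|F (x1, x2)| <= C * expR (- (c * (x2 - xi.2) ^+ 2)) &
        `|f (x1, x2)| <= C * expR (- (c * (x2 - xi.2) ^+ 2))].
Proof.
have nrm g : gauss_dominated xi g -> gauss_dominated xi (fun x => `|g x|).
  by move=> [C [c [C0 c0 gC]]]; exists C, c; split=> // x; rewrite normr_id.
move=> /nrm gF /nrm gf; have [C [c [C0 c0 H]]] := gauss_dominatedD gF gf.
exists C, c; split => // x1 x2.
have {}H : `|F (x1, x2)| + `|f (x1, x2)| <= C * expR (- (c * sqdist xi (x1, x2))).
  exact: le_trans (ler_norm _) (H (x1, x2)).
have H1 : `|F (x1, x2)| + `|f (x1, x2)| <= C * expR (- (c * (x1 - xi.1) ^+ 2)).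
  rewrite (le_trans H)// ler_pM2l// ler_expR lerN2 ler_pM2l//.
  by rewrite lerDl sqr_ge0.
have H2 : `|F (x1, x2)| + `|f (x1, x2)| <= C * expR (- (c * (x2 - xi.2) ^+ 2)).
  rewrite (le_trans H)// ler_pM2l// ler_expR lerN2 ler_pM2l//.
  by rewrite lerDr sqr_ge0.
by split; [apply: le_trans H1|apply: le_trans H1|
  apply: le_trans H2|apply: le_trans H2]; rewrite ?lerDl ?lerDr.
Qed.

Lemma continuous_slice1 (f : plane R -> R) (x2 : R) :
  continuous f -> continuous (fun x1 : R => f (x1, x2)).
Proof.
move=> cf x1; apply: (@continuous_comp _ _ _ (fun s : R => (s, x2)) f _ _ (cf _)).
exact: (cvg_pair cvg_id (cvg_cst x2)).
Qed.

Lemma continuous_slice2 (f : plane R -> R) (x1 : R) :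
  continuous f -> continuous (fun x2 : R => f (x1, x2)).
Proof.
move=> cf x2; apply: (@continuous_comp _ _ _ (fun s : R => (x1, s)) f _ _ (cf _)).
exact: (cvg_pair (cvg_cst x1) cvg_id).
Qed.

Lemma Rintegral_slice_derive1_eq0 xi (F f : plane R -> R) :
    (forall x1 x2 : R, is_derive x1 1 (fun s : R => F (s, x2)) (f (x1, x2))) ->
    continuous f -> gauss_dominated xi F -> gauss_dominated xi f ->
  \int[area]_x f x = 0.
Proof.
move=> dF cf gF gf; have [C [c [c0 H]]] := gauss_dominated_slices gF gf.
rewrite /Rintegral -integral21_prod_meas1; last exact: gauss_dominated_integrable gf.
rewrite integral0_eq// => x2 _; rewrite /fubini_G.
apply: (@integral_derive_gauss_eq0 _ (fun s : R => F (s, x2))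
  (fun s : R => f (s, x2)) xi.1 C c) => // [|x1|x1].
- exact: continuous_slice1.
- by have [] := H x1 x2.
- by have [] := H x1 x2.
Qed.

Lemma Rintegral_slice_derive2_eq0 xi (F f : plane R -> R) :
    (forall x1 x2 : R, is_derive x2 1 (fun s : R => F (x1, s)) (f (x1, x2))) ->
    continuous f -> gauss_dominated xi F -> gauss_dominated xi f ->
  \int[area]_x f x = 0.
Proof.
move=> dF cf gF gf; have [C [c [c0 H]]] := gauss_dominated_slices gF gf.
rewrite /Rintegral -integral12_prod_meas1; last exact: gauss_dominated_integrable gf.
rewrite integral0_eq// => x1 _; rewrite /fubini_F.
apply: (@integral_derive_gauss_eq0 _ (fun s : R => F (x1, s))
  (fun s : R => f (x1, s)) xi.2 C c) => // [|x2|x2].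
- exact: continuous_slice2.
- by have [] := H x1 x2.
- by have [] := H x1 x2.
Qed.

Definition gauss_moment (A B D : R) xi a b : R :=
  \int[area]_x (monomial a b xi x * expR (- quad A B D xi x)).

Lemma is_derive_monomial_gauss n (m al be ga s : R) :
  is_derive s 1 (fun s => (s - m) ^+ n * expR (- (al * (s - m) ^+ 2 + be * (s - m) + ga)))
   ((n%:R * (s - m) ^+ n.-1 - (s - m) ^+ n * (2 * al * (s - m) + be)) *
     expR (- (al * (s - m) ^+ 2 + be * (s - m) + ga))).
Proof.
have dh : is_derive s 1 (fun s : R => s - m) 1.
  have := @is_derive_subX R 1 m s; rewrite /= expr0 mulr1.
  by under eq_fun do rewrite expr1.
pose g (s : R) : R := - (al * (s - m) ^+ 2 + be * (s - m) + ga).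
have dg : is_derive s 1 g (- (2 * al * (s - m) + be)).
  have d1 := @is_deriveM R R (cst al) _ s 1 0 _ (is_derive_cst _ _ _) (is_derive_subX 2 m s).
  have d2 := @is_deriveM R R (cst be) _ s 1 0 _ (is_derive_cst _ _ _) dh.
  have d3 := is_deriveD (is_deriveD d1 d2) (@is_derive_cst R R R ga s 1).
  apply: (is_derive_eq (is_deriveN d3)).
  by rewrite /GRing.scale /=; ring.
have de : is_derive s 1 (fun s => expR (g s)) (expR (g s) * - (2 * al * (s - m) + be)).
  exact: (is_derive1_comp (is_derive_expR _) dg).
apply: (is_derive_eq (is_deriveM (is_derive_subX n m s) de)).
by rewrite /GRing.scale /= -/(g s); ring.
Qed.

Lemma Rintegral_gaussD xi (f g : plane R -> R) :
  continuous f -> gauss_dominated xi f -> continuous g -> gauss_dominated xi g ->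
  \int[area]_x (f x + g x) = \int[area]_x f x + \int[area]_x g x.
Proof.
move=> cf gf cg gg; apply: RintegralD => //.
  exact: (gauss_dominated_integrable cf gf).
exact: (gauss_dominated_integrable cg gg).
Qed.

Lemma continuous_monomial_gauss (A B D : R) xi a b :
  continuous (fun x : plane R => monomial a b xi x * expR (- quad A B D xi x)).
Proof.
by move=> x; apply: cvgM; [exact: continuous_monomial|exact: continuous_gauss_weight].
Qed.

Lemma gauss_moment_stein1 (A B D : R) xi a b : 0 < A -> 0 < A * D - B ^+ 2 ->
  2 * A * gauss_moment A B D xi a.+1 b + 2 * B * gauss_moment A B D xi a b.+1 =
  a%:R * gauss_moment A B D xi a.-1 b.
Proof.
move=> A0 dt.
pose m i j (x : plane R) := monomial i j xi x * expR (- quad A B D xi x).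
have cm i j : continuous (m i j) by exact: continuous_monomial_gauss.
have gm i j : gauss_dominated xi (m i j) by exact: monomial_gauss_dominated.
pose f (x : plane R) := a%:R * m a.-1 b x + (- (2 * A) * m a.+1 b x + - (2 * B) * m a b.+1 x).
have ck k i j : continuous (fun x => k * m i j x).
  by move=> x; apply: cvgM; [exact: cvg_cst|exact: cm].
have gk k i j : gauss_dominated xi (fun x => k * m i j x) by exact: gauss_dominatedM.
have : \int[area]_x f x = 0.
  apply: (@Rintegral_slice_derive1_eq0 xi (m a b)).
  - move=> x1 x2.
    have d := @is_derive_monomial_gauss a xi.1 A (2 * B * (x2 - xi.2)) (D * (x2 - xi.2) ^+ 2) x1.
    have := is_deriveM (@is_derive_cst R R R ((x2 - xi.2) ^+ b) x1 1) d.
    have -> : cst ((x2 - xi.2) ^+ b) * (fun s : R => (s - xi.1) ^+ a * expR (-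
        (A * (s - xi.1) ^+ 2 + 2 * B * (x2 - xi.2) * (s - xi.1) + D * (x2 - xi.2) ^+ 2))) =
        (fun s => m a b (s, x2)).
      apply/funext => s; rewrite /m /monomial /quad /= mulrfctE /=.
      by rewrite [2 * B * (x2 - xi.2) * _]mulrAC mulrA [_ ^+ b * _]mulrC.
    move/is_derive_eq; apply; rewrite /f /m /monomial /quad /GRing.scale /=.
    rewrite [2 * B * (x2 - xi.2) * _]mulrAC.
    by move: (expR _) => E; rewrite !exprS; ring.
  - by move=> x; apply: cvgD; [|apply: cvgD]; exact: ck.
  - exact: gm.
  - by apply: gauss_dominatedD => //; exact: gauss_dominatedD.
have int k i j : \int[area]_x (k * m i j x) = k * gauss_moment A B D xi i j.
  by rewrite RintegralZl//; exact: gauss_dominated_integrable (gm _ _).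
rewrite (@Rintegral_gaussD xi)//; last 2 first.
- by move=> x; apply: cvgD; exact: ck.
- exact: gauss_dominatedD.
rewrite (@Rintegral_gaussD xi)// !int => /eqP; rewrite addr_eq0 => /eqP ->.
by ring.
Qed.
Lemma gauss_moment_stein2 (A B D : R) xi a b : 0 < A -> 0 < A * D - B ^+ 2 ->
  2 * B * gauss_moment A B D xi a.+1 b + 2 * D * gauss_moment A B D xi a b.+1 =
  b%:R * gauss_moment A B D xi a b.-1.
Proof.
move=> A0 dt.
pose m i j (x : plane R) := monomial i j xi x * expR (- quad A B D xi x).
have cm i j : continuous (m i j) by exact: continuous_monomial_gauss.
have gm i j : gauss_dominated xi (m i j) by exact: monomial_gauss_dominated.
pose f (x : plane R) := b%:R * m a b.-1 x + (- (2 * B) * m a.+1 b x + - (2 * D) * m a b.+1 x).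
have ck k i j : continuous (fun x => k * m i j x).
  by move=> x; apply: cvgM; [exact: cvg_cst|exact: cm].
have gk k i j : gauss_dominated xi (fun x => k * m i j x) by exact: gauss_dominatedM.
have : \int[area]_x f x = 0.
  apply: (@Rintegral_slice_derive2_eq0 xi (m a b)).
  - move=> x1 x2.
    have d := @is_derive_monomial_gauss b xi.2 D (2 * B * (x1 - xi.1)) (A * (x1 - xi.1) ^+ 2) x2.
    have := is_deriveM (@is_derive_cst R R R ((x1 - xi.1) ^+ a) x2 1) d.
    have EE s : D * (s - xi.2) ^+ 2 + 2 * B * (x1 - xi.1) * (s - xi.2) + A * (x1 - xi.1) ^+ 2 =
        A * (x1 - xi.1) ^+ 2 + 2 * B * (x1 - xi.1) * (s - xi.2) + D * (s - xi.2) ^+ 2.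
      by ring.
    have -> : cst ((x1 - xi.1) ^+ a) * (fun s : R => (s - xi.2) ^+ b * expR (-
        (D * (s - xi.2) ^+ 2 + 2 * B * (x1 - xi.1) * (s - xi.2) + A * (x1 - xi.1) ^+ 2))) =
        (fun s => m a b (x1, s)).
      by apply/funext => s; rewrite /m /monomial /quad /= mulrfctE /= EE mulrA.
    move/is_derive_eq; apply; rewrite /f /m /monomial /quad /GRing.scale /= EE.
    by move: (expR _) => E; rewrite !exprS; ring.
  - by move=> x; apply: cvgD; [|apply: cvgD]; exact: ck.
  - exact: gm.
  - by apply: gauss_dominatedD => //; exact: gauss_dominatedD.
have int k i j : \int[area]_x (k * m i j x) = k * gauss_moment A B D xi i j.
  by rewrite RintegralZl//; exact: gauss_dominated_integrable (gm _ _).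
rewrite (@Rintegral_gaussD xi)//; last 2 first.
- by move=> x; apply: cvgD; exact: ck.
- exact: gauss_dominatedD.
rewrite (@Rintegral_gaussD xi)// !int => /eqP; rewrite addr_eq0 => /eqP ->.
by ring.
Qed.
Lemma gauss_moment_rec1 (A B D : R) xi a b : 0 < A -> 0 < A * D - B ^+ 2 ->
  2 * (A * D - B ^+ 2) * gauss_moment A B D xi a.+1 b =
  D * a%:R * gauss_moment A B D xi a.-1 b - B * b%:R * gauss_moment A B D xi a b.-1.
Proof.
move=> A0 dt; rewrite -[D * _ * _]mulrA -[B * _ * _]mulrA.
by rewrite -gauss_moment_stein1// -gauss_moment_stein2//; ring.
Qed.

Lemma gauss_moment_rec2 (A B D : R) xi a b : 0 < A -> 0 < A * D - B ^+ 2 ->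
  2 * (A * D - B ^+ 2) * gauss_moment A B D xi a b.+1 =
  A * b%:R * gauss_moment A B D xi a b.-1 - B * a%:R * gauss_moment A B D xi a.-1 b.
Proof.
move=> A0 dt; rewrite -[A * _ * _]mulrA -[B * _ * _]mulrA.
by rewrite -gauss_moment_stein1// -gauss_moment_stein2//; ring.
Qed.

Lemma gauss_moment00 (A B D : R) xi : 0 < A -> 0 < A * D - B ^+ 2 ->
  gauss_moment A B D xi 0 0 = pi / Num.sqrt (A * D - B ^+ 2).
Proof.
move=> A0 dt; rewrite /gauss_moment /Rintegral.
under eq_integral do rewrite /monomial !expr0 !mul1r.
by rewrite integral_gauss_weight.
Qed.

End GaussianMoments.

(** * Moments as polynomials in the inverse Hessian *)

Section JetPolynomials.
Context {R : realType}.
Implicit Types (f : plane R -> R) (x : plane R) (n : nat).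

Definition jet_X n (v : jet_var n) : jet_poly (R := R) n := mpolyX R (mnm1 (enum_rank v)).

Lemma jet_evalX n (v : jet_var n) f x : jet_eval (jet_X v) f x = jet_value f x v.
Proof. by rewrite /jet_eval mevalXU enum_rankK. Qed.

Lemma jet_evalD n (P Q : jet_poly n) f x :
  jet_eval (P + Q) f x = jet_eval P f x + jet_eval Q f x.
Proof. exact: mevalD. Qed.

Lemma jet_evalM n (P Q : jet_poly n) f x :
  jet_eval (P * Q) f x = jet_eval P f x * jet_eval Q f x.
Proof. exact: mevalM. Qed.

Definition jet_C n (c : R) : jet_poly (R := R) n := mpolyC _ c.

Lemma jet_evalC n (c : R) f x : jet_eval (jet_C n c) f x = c.
Proof. exact: mevalC. Qed.

Lemma jet_eval0 n f x : jet_eval (0 : jet_poly n) f x = 0.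
Proof. exact: meval0. Qed.

Lemma jet_eval_sum n (I : Type) (r : seq I) (p : pred I) (F : I -> jet_poly n) f x :
  jet_eval (\sum_(i <- r | p i) F i) f x = \sum_(i <- r | p i) jet_eval (F i) f x.
Proof.
apply: (big_morph (fun P : jet_poly n => jet_eval P f x)) => [P Q|].
  exact: jet_evalD.
exact: jet_eval0.
Qed.

Definition hess_det f x : R :=
  hessian f x 0 0 * hessian f x 1 1 - hessian f x 0 1 ^+ 2.

Definition hess_posdef f x :=
  [/\ hessian f x 1 0 = hessian f x 0 1, 0 < hessian f x 0 0 & 0 < hess_det f x].

Lemma det_mx22 (M : 'M[R]_2) : \det M = M 0 0 * M 1 1 - M 0 1 * M 1 0.
Proof.
have l0 : lift 0 0 = 1 :> 'I_2 by exact/val_inj.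
have l1 : lift 1 0 = 0 :> 'I_2 by exact/val_inj.
have e1 : lift ord0 ord0 = 1 :> 'I_2 by exact/val_inj.
rewrite (expand_det_row _ 0) !big_ord_recl big_ord0 addr0 e1.
rewrite /cofactor !det_mx11 !mxE l0 l1 /= expr0 expr1.
by rewrite mul1r mulN1r mulrN.
Qed.

Lemma det_hessian f x : hess_posdef f x -> \det (hessian f x) = hess_det f x.
Proof. by move=> [sym _ _]; rewrite det_mx22 sym. Qed.

Lemma invmx_hessian f x : hess_posdef f x ->
  [/\ invmx (hessian f x) 0 0 = hessian f x 1 1 / hess_det f x,
      invmx (hessian f x) 0 1 = - (hessian f x 0 1) / hess_det f x &
      invmx (hessian f x) 1 1 = hessian f x 0 0 / hess_det f x].
Proof.
move=> pd; have [sym _ d0] := pd; have dE := det_hessian pd.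
have u : hessian f x \in unitmx by rewrite unitmxE dE unitfE gt_eqF.
have e1 : lift ord0 ord0 = 1 :> 'I_2 by exact/val_inj.
have E i j : \sum_k hessian f x i k * invmx (hessian f x) k j = (i == j)%:R.
  by have /matrixP/(_ i j) := mulmxV u; rewrite !mxE.
have := (E 0 0, E 0 1, E 1 0, E 1 1); rewrite !big_ord_recl !big_ord0 !addr0 e1 sym.
move: d0; rewrite /hess_det; set K := invmx _; set H := hessian f x => d0.
move=> [[[/= E1 E2] E3] E4].
have dn : H 0 0 * H 1 1 - H 0 1 ^+ 2 != 0 by rewrite gt_eqF.
split; apply: (mulIf dn); rewrite divfK//.
- transitivity (H 1 1 * (H 0 0 * K 0 0 + H 0 1 * K 1 0) -
    H 0 1 * (H 0 1 * K 0 0 + H 1 1 * K 1 0)); first by ring.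
  by rewrite E1 E3; ring.
- transitivity (H 1 1 * (H 0 0 * K 0 1 + H 0 1 * K 1 1) -
    H 0 1 * (H 0 1 * K 0 1 + H 1 1 * K 1 1)); first by ring.
  by rewrite E2 E4; ring.
- transitivity (H 0 0 * (H 0 1 * K 0 1 + H 1 1 * K 1 1) -
    H 0 1 * (H 0 0 * K 0 1 + H 0 1 * K 1 1)); first by ring.
  by rewrite E2 E4; ring.
Qed.

Definition hess_moment f x (t : R) a b : R :=
  gauss_moment (hessian f x 0 0 / (4 * t)) (hessian f x 0 1 / (4 * t))
    (hessian f x 1 1 / (4 * t)) x a b.

Lemma hess_scaled_posdef f x (t : R) : hess_posdef f x -> 0 < t ->
  0 < hessian f x 0 0 / (4 * t) /\
  0 < hessian f x 0 0 / (4 * t) * (hessian f x 1 1 / (4 * t)) -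
      (hessian f x 0 1 / (4 * t)) ^+ 2.
Proof.
move=> [_ h0 d0] t0; split; first by rewrite divr_gt0// mulr_gt0.
have -> : hessian f x 0 0 / (4 * t) * (hessian f x 1 1 / (4 * t)) -
    (hessian f x 0 1 / (4 * t)) ^+ 2 = hess_det f x / (16 * t ^+ 2).
  by rewrite /hess_det; field; rewrite gt_eqF.
by rewrite divr_gt0// mulr_gt0// exprn_gt0.
Qed.

Lemma hess_moment00 f x (t : R) : hess_posdef f x -> 0 < t ->
  hess_moment f x t 0 0 = 4 * pi * t * Num.sqrt (\det (invmx (hessian f x))).
Proof.
move=> pd t0; have [h d] := hess_scaled_posdef pd t0.
rewrite /hess_moment gauss_moment00//.
rewrite det_inv det_hessian//; have [_ _ d0] := pd.
have -> : hessian f x 0 0 / (4 * t) * (hessian f x 1 1 / (4 * t)) -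
    (hessian f x 0 1 / (4 * t)) ^+ 2 = hess_det f x / (4 * t) ^+ 2.
  by rewrite /hess_det; field; rewrite gt_eqF.
rewrite sqrtrM ?ltW// sqrtrV ?exprn_ge0 ?mulr_ge0 ?ltW//.
rewrite sqrtr_sqr gtr0_norm ?mulr_gt0// sqrtrV ?ltW//.
have : Num.sqrt (hess_det f x) != 0 by rewrite gt_eqF// sqrtr_gt0.
by move: (Num.sqrt _) => s s0; field; rewrite s0 gt_eqF.
Qed.

Lemma hess_moment_rec1 f x (t : R) a b : hess_posdef f x -> 0 < t ->
  hess_moment f x t a.+1 b = 2 * t *
    (invmx (hessian f x) 0 0 * a%:R * hess_moment f x t a.-1 b +
     invmx (hessian f x) 0 1 * b%:R * hess_moment f x t a b.-1).
Proof.
move=> pd t0; have [h d] := hess_scaled_posdef pd t0.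
have [-> -> _] := invmx_hessian pd; have [_ _ d0] := pd.
have := gauss_moment_rec1 x a b h d.
rewrite -/(hess_moment f x t a.+1 b) -/(hess_moment f x t a.-1 b) -/(hess_moment f x t a b.-1).
move: (hess_moment f x t a.+1 b) (hess_moment f x t a.-1 b) (hess_moment f x t a b.-1) => M1 M2 M3.
move: d0; rewrite /hess_det; move: (hessian f x 0 0) (hessian f x 0 1) (hessian f x 1 1).
move=> A B D d0 E.
have dn : A * D - B ^+ 2 != 0 by rewrite gt_eqF.
have tn : t != 0 by rewrite gt_eqF.
have -> : M1 = (8 * t ^+ 2) / (A * D - B ^+ 2) *
    (2 * (A / (4 * t) * (D / (4 * t)) - (B / (4 * t)) ^+ 2) * M1).
  by field; rewrite tn dn.
by rewrite E; field; rewrite tn dn.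
Qed.

Lemma hess_moment_rec2 f x (t : R) b : hess_posdef f x -> 0 < t ->
  hess_moment f x t 0 b.+1 = 2 * t *
    (invmx (hessian f x) 1 1 * b%:R * hess_moment f x t 0 b.-1).
Proof.
move=> pd t0; have [h d] := hess_scaled_posdef pd t0.
have [_ _ ->] := invmx_hessian pd; have [_ _ d0] := pd.
have := gauss_moment_rec2 x 0 b h d; rewrite mulr0 mul0r subr0.
rewrite -/(hess_moment f x t 0 b.+1) -/(hess_moment f x t 0 b.-1).
move: (hess_moment f x t 0 b.+1) (hess_moment f x t 0 b.-1) => M1 M2.
move: d0; rewrite /hess_det; move: (hessian f x 0 0) (hessian f x 0 1) (hessian f x 1 1).
move=> A B D d0 E.
have dn : A * D - B ^+ 2 != 0 by rewrite gt_eqF.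
have tn : t != 0 by rewrite gt_eqF.
have -> : M1 = (8 * t ^+ 2) / (A * D - B ^+ 2) *
    (2 * (A / (4 * t) * (D / (4 * t)) - (B / (4 * t)) ^+ 2) * M1).
  by field; rewrite tn dn.
by rewrite E; field; rewrite tn dn.
Qed.

Definition even_pow (t : R) n : R := if odd n then 0 else t ^+ n./2.

Lemma even_powS (t : R) n : even_pow t n.+2 = t * even_pow t n.
Proof. by rewrite /even_pow /= negbK; case: ifP; rewrite ?mulr0// exprS. Qed.

Lemma hess_moment_jet_poly n a b : exists W : jet_poly n, forall f x (t : R),
  hess_posdef f x -> 0 < t ->
  hess_moment f x t a b = even_pow t (a + b) * jet_eval W f x * hess_moment f x t 0 0.
Proof.
have [m] := ubnP (a + b); elim: m a b => // m IH [|a] [|b] abm.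
- exists 1 => f x t _ _; rewrite /even_pow /= /jet_eval meval1; ring.
- have [|W HW] := IH 0%N b.-1; first by rewrite -ltnS (leq_trans _ abm)// !add0n !ltnS leq_pred.
  exists (jet_C n 2 * (jet_X (inr (1, 1)) * jet_C n b%:R) * W) => f x t pd t0.
  rewrite hess_moment_rec2// HW// !jet_evalM !jet_evalC jet_evalX /jet_value !add0n.
  case: b abm HW => [|b] abm HW; first by rewrite !mulr0n; ring.
  by rewrite even_powS /=; ring.
- have [|W HW] := IH a.-1 0%N; first by rewrite -ltnS (leq_trans _ abm)// !addn0 !ltnS leq_pred.
  exists (jet_C n 2 * (jet_X (inr (0, 0)) * jet_C n a%:R) * W) => f x t pd t0.
  rewrite hess_moment_rec1// mulr0 mul0r addr0 HW// !jet_evalM !jet_evalC jet_evalX.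
  rewrite /jet_value !addn0; case: a abm HW => [|a] abm HW; first by rewrite !mulr0n; ring.
  by rewrite even_powS /=; ring.
- have [|W HW] := IH a.-1 b.+1; first by rewrite -ltnS (leq_trans _ abm)// addSn !ltnS leq_add2r leq_pred.
  have [|V HV] := IH a b; first by rewrite -ltnS (leq_trans _ abm)// addSn addnS !ltnS leqnSn.
  exists (jet_C n 2 * (jet_X (inr (0, 0)) * jet_C n a%:R * W +
    jet_X (inr (0, 1)) * jet_C n b.+1%:R * V)) => f x t pd t0.
  rewrite hess_moment_rec1// HW// HV// !jet_evalM jet_evalD !jet_evalM !jet_evalC !jet_evalX.
  rewrite /jet_value [(a.+1 + _)%N]addSn [(a + b.+1)%N]addnS even_powS.
  case: a abm HW HV => [|a] abm HW HV; first by rewrite !mulr0n; ring.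
  by rewrite /= addSn addnS; ring.
Qed.

End JetPolynomials.

(** * Smooth functions and Taylor's formula *)

Section SmoothFunctions.
Context {R : realType}.
Implicit Types (f g : plane R -> R) (x : plane R) (i : 'I_2).

Lemma is_derive_slice1 f x (d : R) :
  is_derive x (basis_vec 0) f d <-> is_derive x.1 1 (fun s : R => f (s, x.2)) d.
Proof.
have E : (fun h : R => h^-1 *: ((f \o shift x) (h *: basis_vec 0) - f x)) =
    (fun h : R => h^-1 *: (((fun s : R => f (s, x.2)) \o shift x.1) (h *: (1 : R)) - f (x.1, x.2))).
  apply/funext => h; case: x => x1 x2 /=; congr (_ *: (f _ - _)).
  by congr pair; rewrite /= ?scaler0 ?add0r.
split => -[D1 D2]; split.
- by move: D1; rewrite /derivable E.
- by move: D2; rewrite /derive E.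
- by rewrite /derivable E.
- by rewrite /derive E.
Qed.

Lemma is_derive_slice2 f x (d : R) :
  is_derive x (basis_vec 1) f d <-> is_derive x.2 1 (fun s : R => f (x.1, s)) d.
Proof.
have E : (fun h : R => h^-1 *: ((f \o shift x) (h *: basis_vec 1) - f x)) =
    (fun h : R => h^-1 *: (((fun s : R => f (x.1, s)) \o shift x.2) (h *: (1 : R)) - f (x.1, x.2))).
  apply/funext => h; case: x => x1 x2 /=; congr (_ *: (f _ - _)).
  by congr pair; rewrite /= ?scaler0 ?add0r.
split => -[D1 D2]; split.
- by move: D1; rewrite /derivable E.
- by move: D2; rewrite /derive E.
- by rewrite /derivable E.
- by rewrite /derive E.
Qed.

Lemma ord2P i : i = 0 \/ i = 1.
Proof. by case: i => -[|[|//]] ?; [left|right]; exact/val_inj. Qed.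

Lemma iter_partial_rcons (s : seq 'I_2) i f :
  iter_partial (rcons s i) f = iter_partial s (partial i f).
Proof. by rewrite /iter_partial foldr_rcons. Qed.

Lemma iter_partial_cat (s t : seq 'I_2) f :
  iter_partial (s ++ t) f = iter_partial s (iter_partial t f).
Proof. by rewrite /iter_partial foldr_cat. Qed.

Lemma smooth_coind (P : (plane R -> R) -> Prop) :
    (forall f, P f -> continuous f /\
      forall i, (forall x, derivable f x (basis_vec i)) /\ P (partial i f)) ->
  forall f, P f -> smooth f.
Proof.
move=> HP f Pf s; elim/last_ind: s f Pf => [|s i IH] f Pf.
  by have [cf df] := HP f Pf; split => // i x; have [] := df i.
rewrite iter_partial_rcons; apply: IH.
by have [_ /(_ i)[]] := HP f Pf.
Qed.

Lemma smooth_partial i f : smooth f -> smooth (partial i f).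
Proof. by move=> sf s; rewrite -iter_partial_rcons. Qed.

Lemma smooth_continuous f : smooth f -> continuous f.
Proof. by move=> /(_ [::])[]. Qed.

Lemma smooth_derivable f i x : smooth f -> derivable f x (basis_vec i).
Proof. by move=> /(_ [::])[]. Qed.

Lemma smooth_iter_partial s f : smooth f -> smooth (iter_partial s f).
Proof. by move=> sf t; rewrite -iter_partial_cat. Qed.

Inductive smooth_ring : (plane R -> R) -> Prop :=
| SRsmooth f of smooth f : smooth_ring f
| SRcst c : smooth_ring (fun=> c)
| SRfst : smooth_ring fst
| SRsnd : smooth_ring snd
| SRadd f g of smooth_ring f & smooth_ring g : smooth_ring (fun x => f x + g x)
| SRmul f g of smooth_ring f & smooth_ring g : smooth_ring (fun x => f x * g x).

Lemma is_derive_fst x i : is_derive x (basis_vec i) (fst : plane R -> R) (i == 0)%:R.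
Proof.
have [->|->] := ord2P i.
  by apply/is_derive_slice1; exact: is_derive_id.
by apply/is_derive_slice2; exact: is_derive_cst.
Qed.

Lemma is_derive_snd x i : is_derive x (basis_vec i) (snd : plane R -> R) (i == 1)%:R.
Proof.
have [->|->] := ord2P i.
  by apply/is_derive_slice1; exact: is_derive_cst.
by apply/is_derive_slice2; exact: is_derive_id.
Qed.

Lemma partialD i f g : (forall x, derivable f x (basis_vec i)) ->
    (forall x, derivable g x (basis_vec i)) ->
  partial i (fun x => f x + g x) = (fun x => partial i f x + partial i g x).
Proof. by move=> df dg; apply/funext => x; rewrite /partial (deriveD (df x) (dg x)). Qed.

Lemma partialM i f g : (forall x, derivable f x (basis_vec i)) ->
    (forall x, derivable g x (basis_vec i)) ->
  partial i (fun x => f x * g x) =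
  (fun x => f x * partial i g x + g x * partial i f x).
Proof. by move=> df dg; apply/funext => x; rewrite /partial (deriveM (df x) (dg x)). Qed.

Lemma partial_cst i (c : R) : partial i (fun=> c) = fun=> 0.
Proof. by apply/funext => x; rewrite /partial (derive_cst c). Qed.

Lemma smooth_ring_smooth f : smooth_ring f -> smooth f.
Proof.
apply: smooth_coind => {}f; elim=> {f}.
- move=> f sf; split; first exact: smooth_continuous.
  move=> i; split; first by move=> x; exact: smooth_derivable.
  by apply: SRsmooth; exact: smooth_partial.
- move=> c; split; first by move=> x; exact: cvg_cst.
  by move=> i; split; [move=> x; exact: derivable_cst|rewrite partial_cst; exact: SRcst].
- split; first by move=> x; exact: cvg_fst.
  move=> i; split; first by move=> x; have [] := is_derive_fst x i.
  have -> : partial i fst = fun=> (i == 0)%:R :> R; last exact: SRcst.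
  by apply/funext => x; have [] := is_derive_fst x i.
- split; first by move=> x; exact: cvg_snd.
  move=> i; split; first by move=> x; have [] := is_derive_snd x i.
  have -> : partial i snd = fun=> (i == 1)%:R :> R; last exact: SRcst.
  by apply/funext => x; have [] := is_derive_snd x i.
- move=> f g Pf [cf df] Pg [cg dg]; split; first by move=> x; apply: cvgD; [exact: cf|exact: cg].
  move=> i; have [dfi Pfi] := df i; have [dgi Pgi] := dg i; split.
    by move=> x; exact: derivableD.
  by rewrite partialD//; exact: SRadd.
- move=> f g Pf [cf df] Pg [cg dg]; split; first by move=> x; apply: cvgM; [exact: cf|exact: cg].
  move=> i; have [dfi Pfi] := df i; have [dgi Pgi] := dg i; split.
    by move=> x; exact: derivableM.
  by rewrite partialM//; apply: SRadd; exact: SRmul.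
Qed.

End SmoothFunctions.

Section Taylor.
Context {R : realType}.
Implicit Types (f g : plane R -> R) (x xi : plane R).

Lemma taylor_bound n (g : nat -> R -> R) (a r M : R) :
    (forall k (y : R), is_derive y 1 (g k) (g k.+1 y)) ->
    (forall y, `|y - a| < r -> `|g n y| <= M) ->
  forall s, `|s - a| < r ->
  `|g 0%N s - \sum_(k < n) g k a / k`!%:R * (s - a) ^+ k| <= M * `|s - a| ^+ n.
Proof.
elim: n g => [|n IH] g dg gM s sr.
  by rewrite big_ord0 subr0 expr0 mulr1 gM.
pose h (y : R) := g 0%N y - \sum_(k < n.+1) g k a / k`!%:R * (y - a) ^+ k.
pose h' (y : R) := g 1%N y - \sum_(k < n) g k.+1 a / k`!%:R * (y - a) ^+ k.
have dh (y : R) : is_derive y 1 h (h' y).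
  have d (k : 'I_n.+1) : is_derive y 1 (fun z : R => g k a / k`!%:R * (z - a) ^+ k)
      (g k a / k`!%:R * (k%:R * (y - a) ^+ k.-1)).
    apply: is_derive_eq (is_deriveM (@is_derive_cst R R R (g k a / k`!%:R) y 1) (is_derive_subX k a y)) _.
    by rewrite scaler0 addr0.
  have D := is_deriveB (dg 0%N y) (is_derive_sum d); rewrite fct_sumE in D.
  apply: (is_derive_eq D); rewrite /h'; congr (_ - _).
  rewrite big_ord_recl mul0r mulr0 add0r; apply: eq_bigr => k _.
  rewrite /= /bump /= add1n factS natrM mulrA; congr (_ * _).
  by rewrite invfM mulrA mulrAC divfK// pnatr_eq0.
have h'M (y : R) : `|y - a| < r -> `|h' y| <= M * `|y - a| ^+ n.
  by apply: (IH (fun k => g k.+1)) => // k z; exact: dg.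
have ha : h a = 0.
  rewrite /h big_ord_recl subrr expr0 mulr1 fact0 divr1 big1 ?addr0 ?subrr// => i _.
  by rewrite expr0n mulr0.
have [c ca hc] : exists2 c, `|c - a| <= `|s - a| & h s = h' c * (s - a).
  have ch (A : set R) : {within A, continuous h}.
    apply: continuous_subspaceT => y; apply: differentiable_continuous.
    by apply/derivable1_diffP; have [] := dh y.
  have [sa|/ltW sa] := leP a s.
    have [c] := MVT_segment sa (fun y _ => dh y) (ch _).
    rewrite in_itv /= => /andP[ac cs]; rewrite ha subr0 => E; exists c => //.
    by rewrite !ger0_norm ?subr_ge0// lerD2r.
  have [c] := MVT_segment sa (fun y _ => dh y) (ch _).
  rewrite in_itv /= => /andP[sc ca]; rewrite ha sub0r => /eqP; rewrite eqr_oppLR => /eqP E; exists c.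
    by rewrite !ler0_norm ?subr_le0// lerN2 lerD2r.
  by rewrite E -mulrN opprB.
rewrite -/(h s) hc normrM exprSr mulrA ler_wpM2r//.
rewrite (le_trans (h'M _ _)) ?(le_lt_trans ca)// ler_wpM2l ?lerXn2r ?nnegrE//.
by rewrite (le_trans _ (gM s sr)).
Qed.

Lemma locally_bounded n (F : nat -> plane R -> R) xi :
    (forall k, continuous (F k)) ->
  exists M r : R, [/\ 0 <= M, 0 < r & forall k x, (k <= n)%N ->
    `|x.1 - xi.1| < r -> `|x.2 - xi.2| < r -> `|F k x| <= M].
Proof.
move=> cF.
have loc k : exists M r : R, [/\ 0 <= M, 0 < r & forall x,
    `|x.1 - xi.1| < r -> `|x.2 - xi.2| < r -> `|F k x| <= M].
  have /cvgr_dist_lt/(_ 1 ltr01)/nbhs_ballP[r /= r0 H] := cF k xi.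
  exists (`|F k xi| + 1), r; split => // x x1 x2.
  have : `|F k xi - F k x| < 1 by apply: H; split; rewrite /ball /= distrC.
  rewrite distrC => /ltW h; rewrite -(subrK (F k xi) (F k x)) addrC.
  by rewrite (le_trans (ler_normD _ _))// lerD2l.
elim: n => [|n [M [r [M0 r0 H]]]].
  have [M [r [M0 r0 H]]] := loc 0%N; exists M, r; split => // k x.
  by rewrite leqn0 => /eqP ->; exact: H.
have [M' [r' [M'0 r'0 H']]] := loc n.+1.
exists (M + M'), (Num.min r r'); split; [exact: addr_ge0|by rewrite lt_min r0|].
move=> k x; rewrite leq_eqVlt !lt_min => /predU1P[->|kn] /andP[x1 x1'] /andP[x2 x2'].
  by rewrite (le_trans (H' _ _ _))// lerDr.
by rewrite (le_trans (H _ _ _ _ _))// lerDl.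
Qed.

Definition mixed_partial a b f := iter_partial (nseq a 0 ++ nseq b 1) f.

Lemma is_derive_mixed_partial1 f a b (x1 x2 : R) : smooth f ->
  is_derive x1 1 (fun s : R => mixed_partial a b f (s, x2)) (mixed_partial a.+1 b f (x1, x2)).
Proof.
move=> sf; apply/(is_derive_slice1 _ (x1, x2)); apply: derivableP.
by apply: smooth_derivable; exact: smooth_iter_partial.
Qed.

Lemma is_derive_mixed_partial2 f b (x1 x2 : R) : smooth f ->
  is_derive x2 1 (fun s : R => mixed_partial 0 b f (x1, s)) (mixed_partial 0 b.+1 f (x1, x2)).
Proof.
move=> sf; apply/(is_derive_slice2 _ (x1, x2)); apply: derivableP.
by apply: smooth_derivable; exact: smooth_iter_partial.
Qed.

Definition taylor_coef f xi a b : R := mixed_partial a b f xi / (a`!%:R * b`!%:R).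

Lemma taylor_plane f xi N : smooth f -> exists C r : R, [/\ 0 <= C, 0 < r &
  forall x, `|x.1 - xi.1| < r -> `|x.2 - xi.2| < r ->
  `|f x - \sum_(b < N) \sum_(a < N - b) taylor_coef f xi a b * monomial a b xi x| <=
    C * dist xi x ^+ N].
Proof.
move=> sf.
have [M [r [M0 r0 HM]]] := @locally_bounded N (fun b => mixed_partial (N - b) b f) xi
  (fun b => smooth_continuous (smooth_iter_partial _ sf)).
exists (M * N.+1%:R), r; split=> [||[x1 x2] /= h1 h2]; [exact: mulr_ge0|by []|].
have T2 : `|f (x1, x2) - \sum_(b < N) mixed_partial 0 b f (x1, xi.2) / b`!%:R *
    (x2 - xi.2) ^+ b| <= M * dist xi (x1, x2) ^+ N.
  apply: (@le_trans _ _ (M * `|x2 - xi.2| ^+ N)).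
    apply: (@taylor_bound N (fun b y => mixed_partial 0 b f (x1, y)) xi.2 r M _ _ x2 h2) => [k y|y yr].
      exact: is_derive_mixed_partial2.
    by have := HM N (x1, y) (leqnn _) h1 yr; rewrite subnn.
  by rewrite ler_wpM2l// lerXn2r ?nnegrE ?dist_ge0// (le_dist2 xi (x1, x2)).
have T1 (b : 'I_N) : `|mixed_partial 0 b f (x1, xi.2) / b`!%:R * (x2 - xi.2) ^+ b -
    \sum_(a < N - b) taylor_coef f xi a b * monomial a b xi (x1, x2)| <=
    M * dist xi (x1, x2) ^+ N.
  have -> : \sum_(a < N - b) taylor_coef f xi a b * monomial a b xi (x1, x2) =
     (\sum_(a < N - b) mixed_partial a b f (xi.1, xi.2) / a`!%:R * (x1 - xi.1) ^+ a) / b`!%:R *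
     (x2 - xi.2) ^+ b.
    rewrite !mulr_suml; apply: eq_bigr => a _; rewrite /taylor_coef /monomial /= -surjective_pairing.
    by rewrite invfM; ring.
  rewrite -!mulrBl !normrM -mulrA.
  apply: (@le_trans _ _ (M * `|x1 - xi.1| ^+ (N - b) * `|x2 - xi.2| ^+ b)).
    have bnd : `|mixed_partial 0 b f (x1, xi.2) -
        \sum_(a < N - b) mixed_partial a b f (xi.1, xi.2) / a`!%:R * (x1 - xi.1) ^+ a| <=
        M * `|x1 - xi.1| ^+ (N - b).
      apply: (@taylor_bound (N - b) (fun a y => mixed_partial a b f (y, xi.2)) xi.1 r M _ _ x1 h1) => [k y|y yr].
        exact: is_derive_mixed_partial1.
      by apply: (HM b (y, xi.2)) => //=; [exact: ltnW|rewrite subrr normr0].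
    apply: ler_pM => //.
    rewrite -normrX ler_piMl// ger0_norm ?invr_ge0// invf_le1 ?ltr0n ?fact_gt0//.
    by rewrite ler1n fact_gt0.
  rewrite -mulrA ler_wpM2l//.
  have -> : dist xi (x1, x2) ^+ N = dist xi (x1, x2) ^+ (N - b) * dist xi (x1, x2) ^+ b.
    by rewrite -exprD subnK// ltnW.
  apply: ler_pM; rewrite ?exprn_ge0// lerXn2r ?nnegrE ?dist_ge0//.
    exact: (le_dist1 xi (x1, x2)).
  exact: (le_dist2 xi (x1, x2)).
rewrite -[X in `|X|](subrKA (\sum_(b < N) mixed_partial 0 b f (x1, xi.2) / b`!%:R * (x2 - xi.2) ^+ b)).
rewrite (le_trans (ler_normD _ _))// mulrAC -natr1 mulrDr mulr1 addrC lerD//.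
rewrite -sumrB (le_trans (ler_norm_sum _ _ _))//.
rewrite (le_trans (ler_sum _ (fun b _ => T1 b)))//.
by rewrite sumr_const card_ord mulr_natr.
Qed.

End Taylor.

(** * The displacement function *)

Section Displacement.
Context {R : realType}.

Lemma quadratic_form_mx22 (M : 'M[R]_2) (v : 'cV[R]_2) :
  (v^T *m M *m v) ord0 ord0 = M 0 0 * v 0 0 ^+ 2 +
    (M 0 1 + M 1 0) * v 0 0 * v 1 0 + M 1 1 * v 1 0 ^+ 2.
Proof.
have e1 : lift ord0 ord0 = 1 :> 'I_2 by exact/val_inj.
rewrite mxE !big_ord_recl big_ord0 addr0 e1 !mxE !big_ord_recl !big_ord0 !addr0 e1.
rewrite ![v^T _ _]mxE.
move: (M _ _) (M _ _) (M _ _) (M _ _) (v _ _) (v _ _) => *; ring.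
Qed.

Context (Phi : plane R -> plane R) (xi : plane R)
  (sPhi : smooth_map Phi) (fixPhi : fixed_points Phi = [set xi]).
Local Notation S := (displacement Phi).

Let u1 x := (Phi x).1 + -1 * x.1.
Let u2 x := (Phi x).2 + -1 * x.2.

Let SE : S = fun x => 2^-1 * (u1 x * u1 x + u2 x * u2 x).
Proof.
by apply/funext => x; rewrite /displacement /sigma /u1 /u2; ring.
Qed.

Let smooth_u1 : smooth u1.
Proof.
apply: smooth_ring_smooth; apply: SRadd; first exact: SRsmooth sPhi.1.
by apply: SRmul; [exact: SRcst|exact: SRfst].
Qed.

Let smooth_u2 : smooth u2.
Proof.
apply: smooth_ring_smooth; apply: SRadd; first exact: SRsmooth sPhi.2.
by apply: SRmul; [exact: SRcst|exact: SRsnd].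
Qed.

Let smooth_ring_sq (u v : plane R -> R) : smooth u -> smooth v -> 
  smooth (fun x => u x * v x).
Proof. by move=> su sv; apply: smooth_ring_smooth; apply: SRmul; exact: SRsmooth. Qed.

Let smoothD (u v : plane R -> R) : smooth u -> smooth v -> 
  smooth (fun x => u x + v x).
Proof. by move=> su sv; apply: smooth_ring_smooth; apply: SRadd; exact: SRsmooth. Qed.

Let smooth_cst (c : R) : smooth (fun=> c).
Proof. by apply: smooth_ring_smooth; exact: SRcst. Qed.

Lemma smooth_displacement : smooth S.
Proof.
rewrite SE; apply: smooth_ring_sq; first exact: smooth_cst.
by apply: smoothD; exact: smooth_ring_sq.
Qed.

Let partial_S j : partial j S = fun x => u1 x * partial j u1 x + u2 x * partial j u2 x.
Proof.
have d u x : smooth u -> derivable u x (basis_vec j) by exact: smooth_derivable.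
rewrite SE partialM; last 2 first.
- by move=> x; apply: d; exact: smooth_cst.
- by move=> x; apply: d; apply: smoothD; exact: smooth_ring_sq.
rewrite partial_cst partialD; last 2 first.
- by move=> x; apply: d; exact: smooth_ring_sq.
- by move=> x; apply: d; exact: smooth_ring_sq.
rewrite !partialM; try by move=> x; exact: d.
by apply/funext => x; rewrite mulr0 addr0; field.
Qed.

Lemma fixedP : Phi xi = xi.
Proof. by have : fixed_points Phi xi by rewrite fixPhi. Qed.

(* [S] is half the squared norm of [Phi - id], which vanishes at [xi], so its
   Hessian there is the Gram matrix of the Jacobian of [Phi - id]. *)
Let hessian_S i j : hessian S xi i j =
  partial i u1 xi * partial j u1 xi + partial i u2 xi * partial j u2 xi.
Proof.
have d u x : smooth u -> derivable u x (basis_vec i) by exact: smooth_derivable.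
have u10 : u1 xi = 0 by rewrite /u1 fixedP mulN1r subrr.
have u20 : u2 xi = 0 by rewrite /u2 fixedP mulN1r subrr.
have p1 := smooth_partial j smooth_u1; have p2 := smooth_partial j smooth_u2.
rewrite mxE partial_S partialD; last 2 first.
- by move=> x; apply: d; exact: smooth_ring_sq.
- by move=> x; apply: d; exact: smooth_ring_sq.
rewrite !partialM; try by move=> x; exact: d.
by rewrite u10 u20 !mul0r !add0r [X in X + _]mulrC [X in _ + X]mulrC.
Qed.

Lemma hess_posdef_displacement : nondegenerate_critical_point S xi -> hess_posdef S xi.
Proof.
move=> [_ ndg].
have nd (a b : R) : (a, b) != (0, 0) -> hessian S xi 0 0 * a ^+ 2 +
    2 * hessian S xi 0 1 * a * b + hessian S xi 1 1 * b ^+ 2 != 0.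
  move=> ab; pose v : 'cV[R]_2 := \col_i (if i == 0 then a else b).
  have v0 : v != 0.
    apply: contra ab => /eqP v0; have /matrixP v0' := v0.
    by have := v0' 0 0; have := v0' 1 0; rewrite !mxE /= => -> ->.
  have E : (v^T *m hessian S xi *m v) ord0 ord0 = hessian S xi 0 0 * a ^+ 2 +
    2 * hessian S xi 0 1 * a * b + hessian S xi 1 1 * b ^+ 2.
    have v00 : v 0 0 = a by rewrite mxE.
    have v10 : v 1 0 = b by rewrite mxE.
    have sym : hessian S xi 1 0 = hessian S xi 0 1.
      by rewrite !hessian_S; congr (_ + _); rewrite mulrC.
    by rewrite quadratic_form_mx22 v00 v10 sym -mulr2n mulr_natl.
  by rewrite -E; case: ndg => /(_ v v0) h; [rewrite gt_eqF|rewrite lt_eqF].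
have h0 : 0 < hessian S xi 0 0.
  have := nd 1 0; rewrite expr0n expr1n mulr1 !mulr0 !addr0 => h.
  rewrite lt_neqAle eq_sym h; last by rewrite xpair_eqE oner_eq0.
  by rewrite hessian_S addr_ge0// -expr2 sqr_ge0.
split => //; first by rewrite !hessian_S; ring.
rewrite lt_neqAle eq_sym; apply/andP; split; last first.
  rewrite /hess_det !hessian_S.
  set a := partial 0 u1 xi; set b := partial 0 u2 xi.
  set c := partial 1 u1 xi; set d := partial 1 u2 xi.
  suff -> : (a * a + b * b) * (c * c + d * d) - (a * c + b * d) ^+ 2 =
    (a * d - b * c) ^+ 2 by exact: sqr_ge0.
  by ring.
have := nd (- hessian S xi 0 1) (hessian S xi 0 0).
rewrite xpair_eqE (gt_eqF h0) andbF => /(_ isT); apply: contra => /eqP dt.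
apply/eqP; transitivity (hessian S xi 0 0 * hess_det S xi); first by rewrite /hess_det; ring.
by rewrite dt mulr0.
Qed.

Lemma displacement_ge0 x : 0 <= S x.
Proof. by rewrite /displacement /sigma mulr_ge0// addr_ge0// sqr_ge0. Qed.

Lemma displacement_fixed : S xi = 0.
Proof. by rewrite /displacement fixedP /sigma !subrr expr0n addr0 mulr0. Qed.

Lemma displacement_eq0 x : S x = 0 -> x = xi.
Proof.
rewrite /displacement /sigma => /eqP; rewrite mulf_eq0 invr_eq0 pnatr_eq0 /=.
rewrite paddr_eq0 ?sqr_ge0// !sqrf_eq0 !subr_eq0 => /andP[/eqP h1 /eqP h2].
have : fixed_points Phi x by rewrite /fixed_points /= [LHS]surjective_pairing h1 h2 -surjective_pairing.
by rewrite fixPhi.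
Qed.

End Displacement.

Section Growth.
Context {R : realType}.
Implicit Types (x xi : plane R) (S : plane R -> R).
Local Notation mu := (@lebesgue_measure R).
Local Notation area := (@lebesgue_measure R \x @lebesgue_measure R)%E.

Definition grows S := exists p r C : R, [/\ 0 < p, 0 < r, 0 < C &
  forall x, r ^+ 2 / 2 < sigma x 0 -> C * (sigma x 0) `^ p <= S x].

Lemma sigma0 x : sigma x 0 = (x.1 ^+ 2 + x.2 ^+ 2) / 2.
Proof. by rewrite /sigma !subr0 mulrC. Qed.

Lemma sigma0_ge0 x : 0 <= sigma x 0.
Proof. by rewrite sigma0 divr_ge0// addr_ge0// sqr_ge0. Qed.

Lemma continuous_inv_oneDsqr : continuous (fun s : R => (oneDsqr s)^-1).
Proof. exact: continuous_oneDsqrV. Qed.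

Lemma inv_oneDsqr_ge0 (s : R) : 0 <= (oneDsqr s)^-1.
Proof. by rewrite invr_ge0 (le_trans ler01)// oneDsqr_ge1. Qed.

Lemma integral_inv_oneDsqr : (\int[mu]_x ((oneDsqr x)^-1)%:E = pi%:E)%E.
Proof.
rewrite ge0_symfun_integralT//=.
- rewrite (_ : [set x | _] = `[0, +oo[%classic); last first.
    by apply/seteqP; split => x/=; rewrite in_itv/= andbT.
  by rewrite integral0y_oneDsqr -EFinM mulrCA divff// mulr1.
- exact: continuous_inv_oneDsqr.
- by move=> s /=; rewrite /oneDsqr sqrrN.
Qed.

Lemma integrable_inv_sqdist : area.-integrable setT
  (fun x => ((oneDsqr x.1)^-1 * (oneDsqr x.2)^-1)%:E).
Proof.
have o0 := inv_oneDsqr_ge0.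
have ms : measurable_fun [set: plane R]
    (fun x => ((oneDsqr x.1)^-1 * (oneDsqr x.2)^-1)%:E).
  apply/measurable_EFinP; apply: continuous_plane_measurable => x; apply: cvgM.
    exact: (continuous_comp (@cvg_fst _ _ _ _ _) (@continuous_inv_oneDsqr _)).
  exact: (continuous_comp (@cvg_snd _ _ _ _ _) (@continuous_inv_oneDsqr _)).
have mo : measurable_fun [set: R] (fun s : R => ((oneDsqr s)^-1)%:E).
  by apply/measurable_EFinP; apply: continuous_measurable_fun; exact: continuous_inv_oneDsqr.
apply/integrableP; split => //.
under eq_integral do rewrite /= ger0_norm ?mulr_ge0//.
rewrite fubini_tonelli1; [|exact: ms|by move=> x; rewrite lee_fin mulr_ge0].
rewrite (_ : integral _ _ _ = \int[mu]_x (((oneDsqr x)^-1)%:E * pi%:E))%E.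
  rewrite ge0_integralZr//=.
  - by rewrite integral_inv_oneDsqr -EFinM ltry.
  - by rewrite lee_fin pi_ge0.
apply: eq_integral => x _; rewrite /fubini_F /= -integral_inv_oneDsqr.
by rewrite -ge0_integralZl.
Qed.

Lemma grows_exp_le S (tau : R) : 0 < tau -> (forall x, 0 <= S x) -> grows S ->
  exists2 K : R, 0 < K & forall x,
    expR (- (tau * S x)) <= K * ((oneDsqr x.1)^-1 * (oneDsqr x.2)^-1).
Proof.
move=> tau0 S0 [p [r [C [p0 r0 C0 HS]]]].
have [n pn] : exists n : nat, 2 <= p * n.+1%:R.
  have := @archi_boundP R (2 / p) (divr_ge0 (ler0n _ 2) (ltW p0)).
  set m := Num.bound _ => h; exists m; rewrite mulrC -ler_pdivrMr//.
  by rewrite ltW// (lt_le_trans h)// ler_nat.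
have tC0 : 0 < tau * C by rewrite mulr_gt0.
pose a := n.+1`!%:R / (tau * C) ^+ n.+1.
have a0 : 0 < a by rewrite divr_gt0 ?ltr0n ?fact_gt0// exprn_gt0.
have r20 : 0 < r ^+ 2 by rewrite exprn_gt0.
pose K := (1 + r ^+ 2) ^+ 2 + (2 / r ^+ 2 + 2) ^+ 2 * (1 + a).
exists K => [|x].
  by rewrite addr_gt0 ?exprn_gt0 ?mulr_gt0// ?exprn_gt0 ?addr_gt0// divr_gt0.
have o0 (s : R) : 0 < oneDsqr s by rewrite (lt_le_trans ltr01)// oneDsqr_ge1.
rewrite -invfM ler_pdivlMr ?mulr_gt0//.
apply: (@le_trans _ _ (expR (- (tau * S x)) * (1 + 2 * sigma x 0) ^+ 2)).
  rewrite ler_wpM2l ?expR_ge0// sigma0 /oneDsqr.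
  rewrite -subr_ge0.
  have -> : (1 + 2 * ((x.1 ^+ 2 + x.2 ^+ 2) / 2)) ^+ 2 - (1 + x.1 ^+ 2) * (1 + x.2 ^+ 2) =
    (x.1 ^+ 2 + x.2 ^+ 2) + (x.1 ^+ 2 * x.1 ^+ 2 + x.2 ^+ 2 * x.2 ^+ 2 + x.1 ^+ 2 * x.2 ^+ 2) by field.
  move: (x.1 ^+ 2) (x.2 ^+ 2) (sqr_ge0 x.1) (sqr_ge0 x.2) => u v u0 v0.
  by apply: addr_ge0; [exact: addr_ge0|apply: addr_ge0; [apply: addr_ge0|]; exact: mulr_ge0].
have s0 := sigma0_ge0 x; move: (sigma x 0) s0 (HS x) => s s0 {}HS.
have [sr|sr] := leP s (r ^+ 2 / 2).
  rewrite -[leRHS]mul1r ler_pM ?expR_ge0// ?exprn_ge0//.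
  - by rewrite addr_ge0// mulr_ge0.
  - by rewrite -expR0 ler_expR oppr_le0 mulr_ge0// ltW.
  rewrite (@le_trans _ _ ((1 + r ^+ 2) ^+ 2))//.
    have q1 : 0 <= 1 + 2 * s by rewrite addr_ge0// mulr_ge0.
    have q2 : 0 <= 1 + r ^+ 2 by rewrite addr_ge0// sqr_ge0.
    by rewrite lerXn2r ?nnegrE// lerD2l mulrC -ler_pdivlMr.
  by rewrite lerDl mulr_ge0 ?sqr_ge0// addr_ge0// ltW.
have {}HS := HS sr.
have e1 : expR (- (tau * S x)) <= expR (- (tau * C * s `^ p)).
  by rewrite ler_expR lerN2 -mulrA ler_pM2l.
have sp : 0 < s by rewrite (lt_trans _ sr)// divr_gt0.
have s1 : 1 + 2 * s <= (2 / r ^+ 2 + 2) * s.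
  rewrite [leRHS]mulrDl lerD2r mulrAC ler_pdivlMr// mul1r.
  by rewrite ltW// mulrC -ltr_pdivrMr.
have s2 : s ^+ 2 <= 1 + (s `^ p) ^+ n.+1.
  have [sl|sl] := leP s 1.
    by rewrite (le_trans (exprn_ile1 _ _ _))// lerDl exprn_ge0// powR_ge0.
  rewrite (@le_trans _ _ ((s `^ p) ^+ n.+1))//; last by rewrite lerDr.
  rewrite -(powR_mulrn n.+1 (powR_ge0 s p)) -powRrM -(powR_mulrn 2 s0).
  by apply: ler_powR => //; exact: ltW.
have y0 : 0 <= tau * C * s `^ p by rewrite mulr_ge0 ?powR_ge0// ltW.
have e2 : (1 + (s `^ p) ^+ n.+1) * expR (- (tau * C * s `^ p)) <= 1 + a.
  rewrite expRN ler_pdivrMr ?expR_gt0// mulrDl mul1r lerD//.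
    by rewrite -expR0 ler_expR.
  have e3 : (tau * C * s `^ p) ^+ n.+1 / n.+1`!%:R <= expR (tau * C * s `^ p).
    by apply: le_trans (expR_ge1Dxn n y0); rewrite lerDr.
  rewrite (le_trans _ (ler_wpM2l (ltW a0) e3))// /a.
  rewrite [(tau * C * _) ^+ n.+1]exprMn -!mulrA mulKf ?expf_neq0 ?gt_eqF//.
  by rewrite mulrC divfK// gt_eqF// ltr0n fact_gt0.
apply: (@le_trans _ _ ((2 / r ^+ 2 + 2) ^+ 2 * (1 + a))); last by rewrite lerDr sqr_ge0.
apply: (@le_trans _ _ (expR (- (tau * C * s `^ p)) * ((2 / r ^+ 2 + 2) ^+ 2 * (1 + (s `^ p) ^+ n.+1)))).
  rewrite ler_pM ?expR_ge0 ?sqr_ge0//.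
  rewrite (@le_trans _ _ (((2 / r ^+ 2 + 2) * s) ^+ 2))//.
    have q1 : 0 <= 1 + 2 * s by rewrite addr_ge0// mulr_ge0.
    by rewrite lerXn2r ?nnegrE// (le_trans q1).
  by rewrite exprMn ler_wpM2l// sqr_ge0.
by rewrite mulrCA ler_wpM2l ?sqr_ge0// mulrC.
Qed.

Lemma grows_integrable S (tau : R) : 0 < tau -> (forall x, 0 <= S x) ->
    continuous S -> grows S ->
  area.-integrable setT (fun x => (expR (- (tau * S x)))%:E).
Proof.
move=> tau0 S0 cS gS; have [K K0 HK] := grows_exp_le tau0 S0 gS.
apply: (@le_integrable _ _ R area setT measurableT (fun x => (expR (- (tau * S x)))%:E)
  (fun x => (K%:E * ((oneDsqr x.1)^-1 * (oneDsqr x.2)^-1)%:E)%E)).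
- apply/measurable_EFinP; apply: continuous_plane_measurable => x.
  apply: continuous_comp; last exact: continuous_expR.
  by apply: cvgN; apply: cvgM; [exact: cvg_cst|exact: cS].
- move=> x _; rewrite -EFinM lee_fin ger0_norm ?expR_ge0//.
  by rewrite (le_trans (HK x))// ler_norm.
- by apply: integrableZl => //; exact: integrable_inv_sqdist.
Qed.

Lemma grows_away S xi (d : R) : 0 < d -> (forall x, 0 <= S x) ->
    (forall x, S x = 0 -> x = xi) -> continuous S -> grows S ->
  exists2 e : R, 0 < e & forall x, d <= dist xi x -> e <= S x.
Proof.
move=> d0 S0 Sxi cS [p [r [C [p0 r0 C0 HS]]]].
pose g x := S x + (`|d ^+ 2 - sqdist xi x| + (d ^+ 2 - sqdist xi x)).
have cg : continuous g.
  have cq : continuous (fun x => d ^+ 2 - sqdist xi x).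
    move=> x; apply: cvgB; first exact: cvg_cst.
    by apply: cvgD;
      [exact: (continuous_comp (@continuous_coord1 R xi x) (@exprn_continuous R 2 _))
      |exact: (continuous_comp (@continuous_coord2 R xi x) (@exprn_continuous R 2 _))].
  move=> x; apply: cvgD; first exact: cS.
  apply: cvgD; last exact: cq.
  exact: (continuous_comp (cq x) (@norm_continuous _ _ _)).
have g0 x : 0 < g x.
  have h0 : 0 <= `|d ^+ 2 - sqdist xi x| + (d ^+ 2 - sqdist xi x).
    by rewrite -lerBlDr sub0r -normrN ler_norm.
  rewrite lt_neqAle addr_ge0// andbT eq_sym /g paddr_eq0//; apply/negP.
  move=> /andP[/eqP/Sxi -> ]; rewrite /sqdist !subrr expr0n /= addr0 subr0.
  by rewrite gt_eqF// addr_gt0 ?normr_gt0 ?gt_eqF ?exprn_gt0.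
pose A : set (plane R) := `[- r, r]%classic `*` `[- r, r]%classic.
have cA : compact A by apply: compact_setX; exact: segment_compact.
have A0 : A !=set0.
  by exists (0, 0); split => /=; rewrite in_itv /= oppr_le0 ltW.
have [c _ Hc] := compact_EVT_min A0 cA (continuous_subspaceT cg).
exists (Num.min (g c) (C * (r ^+ 2 / 2) `^ p)).
  by rewrite lt_min g0 mulr_gt0// powR_gt0// divr_gt0// exprn_gt0.
move=> x dx; rewrite ge_min; apply/orP.
have [sr|sr] := leP (sigma x 0) (r ^+ 2 / 2); last first.
  right; apply: le_trans (HS x sr); rewrite ler_pM2l//.
  by rewrite ge0_ler_powR ?nnegrE ?sigma0_ge0 ?ltW// divr_gt0 ?exprn_gt0.
left; have xA : x \in A.
  move: sr; rewrite sigma0 ler_pM2r ?invr_gt0// => sr.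
  have h1 : `|x.1| <= r.
    rewrite -(ger0_norm (ltW r0)) -ler_sqr ?nnegrE// !real_normK ?num_real//.
    by apply: le_trans sr; rewrite lerDl sqr_ge0.
  have h2 : `|x.2| <= r.
    rewrite -(ger0_norm (ltW r0)) -ler_sqr ?nnegrE// !real_normK ?num_real//.
    by apply: le_trans sr; rewrite lerDr sqr_ge0.
  by rewrite inE; split => /=; rewrite in_itv /= -ler_norml.
apply: le_trans (Hc x xA) _; rewrite /g gerDl.
have : d ^+ 2 - sqdist xi x <= 0.
  by rewrite subr_le0 -dist_sqr lerXn2r ?nnegrE ?dist_ge0// ltW.
by move=> h; rewrite ler0_norm// addNr.
Qed.

End Growth.

(** * Laplace's method *)

Section LaplaceEstimate.
Context {R : realType}.
Implicit Types (x : plane R).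
Local Notation area := (@lebesgue_measure R \x @lebesgue_measure R)%E.

Lemma pow_gauss_scaled n (c : R) : 0 < c -> exists2 C : R, 0 < C &
  forall t y : R, 0 < t -> 0 <= y -> y ^+ n * expR (- (c * y ^+ 2 / t)) <= C * Num.sqrt t ^+ n.
Proof.
move=> c0; have [C C0 HC] := pow_gauss_bounded n c0; exists C => // t y t0 y0.
have st0 : 0 < Num.sqrt t by rewrite sqrtr_gt0.
rewrite -ler_pdivrMr ?exprn_gt0// mulrAC -expr_div_n.
have -> : c * y ^+ 2 / t = c * (y / Num.sqrt t) ^+ 2.
  by rewrite expr_div_n sqr_sqrtr ?mulrA// ltW.
by apply: HC; rewrite divr_ge0// ltW.
Qed.

Lemma pow_gauss_scaled_even n (c : R) : 0 < c -> exists2 C : R, 0 < C &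
  forall t y : R, 0 < t -> 0 <= y -> y ^+ (2 * n) * expR (- (c * y ^+ 2 / t)) <= C * t ^+ n.
Proof.
move=> c0; have [C C0 HC] := pow_gauss_scaled (2 * n) c0; exists C => // t y t0 y0.
by rewrite (le_trans (HC _ _ t0 y0))// exprM sqr_sqrtr// ltW.
Qed.

Lemma expR_taylor_bound n (a s : R) :
  `|expR s - \sum_(k < n) expR a / k`!%:R * (s - a) ^+ k| <=
  expR (`|a| + `|s - a| + 1) * `|s - a| ^+ n.
Proof.
have sr : `|s - a| < `|s - a| + 1 by rewrite ltrDl.
apply: (@taylor_bound R n (fun=> expR) a (`|s - a| + 1) _ _ _ s sr) => y ya.
rewrite ger0_norm ?expR_ge0// ler_expR -(subrK a y) addrC -addrA.
by rewrite lerD ?ler_norm// (le_trans (ler_norm _))// ltW.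
Qed.

Lemma expR_diff_bound (a s : R) :
  `|expR s - expR a| <= expR (`|a| + `|s - a| + 1) * `|s - a|.
Proof. by have := expR_taylor_bound 1 a s; rewrite big_ord1 fact0 divr1 expr0 mulr1 expr1. Qed.

Lemma expR_sum_bound n (s : R) :
  `|expR s - \sum_(k < n) s ^+ k / k`!%:R| <= expR (`|s| + 1) * `|s| ^+ n.
Proof.
have := expR_taylor_bound n 0 s; rewrite normr0 add0r subr0.
by under eq_bigr do rewrite expR0 mulrC mulrA mulr1.
Qed.

Context (S q T : plane R -> R) (xi : plane R) (kap : R) (K : nat).
Context (kap0 : 0 < kap).
Local Notation rho x := (dist xi x).
Local Notation M := (2 * K.+1)%N.

Definition truncated_exp (t : R) x : R :=
  (\sum_(m < 2 * K.+1) (- (T x / (2 * t))) ^+ m / m`!%:R) * expR (- (q x / (2 * t))).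

Context (q_ge : forall x, kap * sqdist xi x <= q x).

Let q_exp (t : R) x : 0 < t ->
  expR (- (q x / (2 * t))) <= expR (- (kap / 2 * rho x ^+ 2 / t)).
Proof.
move=> t0; rewrite ler_expR lerN2 dist_sqr.
have -> : kap / 2 * sqdist xi x / t = kap * sqdist xi x / (2 * t) by field; rewrite gt_eqF.
by rewrite ler_pM2r ?invr_gt0 ?mulr_gt0.
Qed.

Lemma laplace_inner (C1 C2 r0 : R) : 0 <= C1 -> 0 <= C2 -> 0 < r0 ->
    (forall x, rho x < r0 -> `|S x - (q x + T x)| <= C1 * rho x ^+ (2 * K.+2)) ->
    (forall x, rho x <= 1 -> `|T x| <= C2 * rho x ^+ 3) ->
  exists d C : R, [/\ 0 < d, d <= 1, 0 < C & forall t x, 0 < t -> rho x < d ->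
    `|expR (- (S x / (2 * t))) - truncated_exp t x| <=
    C * t ^+ K.+1 * expR (- (kap / 8 * rho x ^+ 2 / t))].
Proof.
move=> C10 C20 r00 hS hT.
pose d := Num.min (Num.min r0 1) (kap / 8 / (C1 + C2 + 1)).
have CC : 0 < C1 + C2 + 1 by rewrite ltr_wpDl// addr_ge0.
have d0 : 0 < d by rewrite !lt_min r00 ltr01 !divr_gt0.
have d1 : d <= 1 by rewrite !ge_min lexx orbT.
have dr : d <= r0 by rewrite !ge_min lexx.
have dC : (C1 + C2 + 1) * d <= kap / 8.
  by rewrite mulrC -ler_pdivlMr// ge_min lexx orbT.
have k8 : 0 < kap / 8 by rewrite divr_gt0.
have [c1 c10 Hc1] := pow_gauss_scaled_even K.+2 k8.
have [c2 c20 Hc2] := pow_gauss_scaled_even (3 * K.+1) k8.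
exists d, (expR 1 * (C1 * c1 + C2 ^+ M * c2) + 1); split => //.
  by rewrite ltr_wpDl// mulr_ge0 ?expR_ge0// addr_ge0// mulr_ge0 ?exprn_ge0// ltW.
move=> t x t0 xd; have p0 : 0 <= rho x := dist_ge0 _ _.
have p1 : rho x <= 1 by rewrite (le_trans (ltW xd)).
have t2 : 0 < 2 * t by rewrite mulr_gt0.
have [[[d0' t0'] [t2' kap0']] [c10' c20']] := ((ltW d0, ltW t0), (ltW t2, ltW kap0), (ltW c10, ltW c20)).
move: (hS x (lt_le_trans xd dr)) (hT x p1) (q_exp x t0).
rewrite /truncated_exp; move: (rho x) (S x) (q x) (T x) p0 p1 xd => p s u v p0 p1 pd hs hv hu.
have pdp n : p ^+ n.+3 <= d * p ^+ 2.
  rewrite exprS ler_pM ?exprn_ge0 ?(ltW pd)//.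
  by rewrite -addn2 exprD ler_piMl ?exprn_ge0// exprn_ile1.
have e1 : `|s - (u + v)| <= kap / 8 * p ^+ 2.
  apply: (le_trans hs); have -> : (2 * K.+2)%N = (2 * K).+1.+3 by rewrite !mulnS.
  apply: (le_trans (ler_wpM2l C10 (pdp (2 * K).+1))); rewrite mulrA ler_wpM2r ?exprn_ge0//.
  by rewrite (le_trans _ dC)// ler_wpM2r// -addrA lerDl addr_ge0.
have e2 : `|v| <= kap / 8 * p ^+ 2.
  apply: (le_trans hv); apply: (le_trans (ler_wpM2l C20 (pdp 0%N))); rewrite mulrA ler_wpM2r ?exprn_ge0//.
  by rewrite (le_trans _ dC)// ler_wpM2r// addrAC lerDr addr_ge0.
pose y := - ((s - u) / (2 * t)); pose z := - (v / (2 * t)).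
have -> : expR (- (s / (2 * t))) = expR y * expR (- (u / (2 * t))).
  by rewrite -expRD /y; congr expR; field; rewrite gt_eqF.
rewrite -/z -mulrBl normrM (ger0_norm (expR_ge0 _)).
have yz : `|y - z| <= kap / 16 * p ^+ 2 / t.
  have -> : y - z = - ((s - (u + v)) / (2 * t)) by rewrite /y /z; field; rewrite gt_eqF.
  rewrite normrN normrM (ger0_norm (x := _^-1)) ?invr_ge0// ler_pdivrMr//.
  by rewrite (le_trans e1)// le_eqVlt; apply/orP; left; apply/eqP; field; rewrite gt_eqF.
have zz : `|z| <= kap / 16 * p ^+ 2 / t.
  rewrite normrN normrM (ger0_norm (x := _^-1)) ?invr_ge0// ler_pdivrMr//.
  by rewrite (le_trans e2)// le_eqVlt; apply/orP; left; apply/eqP; field; rewrite gt_eqF.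
have kpt : 0 <= kap / 16 * p ^+ 2 / t.
  by rewrite divr_ge0 ?mulr_ge0 ?exprn_ge0 ?divr_ge0.
have ee : expR (`|z| + `|y - z| + 1) <= expR 1 * expR (kap / 8 * p ^+ 2 / t).
  rewrite -expRD ler_expR addrC lerD2l (le_trans (lerD zz yz))// le_eqVlt.
  by apply/orP; left; apply/eqP; field; rewrite gt_eqF.
have ez : expR (`|z| + 1) <= expR 1 * expR (kap / 8 * p ^+ 2 / t).
  by rewrite (le_trans _ ee)// ler_expR lerD2r lerDl.
have D1 : `|expR y - expR z| <= expR 1 * expR (kap / 8 * p ^+ 2 / t) * (C1 * p ^+ (2 * K.+2) / t).
  rewrite (le_trans (expR_diff_bound z y))// ler_pM ?expR_ge0//.
  have -> : y - z = - ((s - (u + v)) / (2 * t)) by rewrite /y /z; field; rewrite gt_eqF.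
  rewrite normrN normrM (ger0_norm (x := _^-1)) ?invr_ge0//.
  rewrite ler_pM ?invr_ge0// lef_pV2 ?posrE//.
  by rewrite mulr_natl mulr2n lerDl.
have D2 : `|expR z - \sum_(m < M) z ^+ m / m`!%:R| <=
    expR 1 * expR (kap / 8 * p ^+ 2 / t) * (C2 ^+ M * p ^+ (2 * (3 * K.+1)) / t ^+ M).
  rewrite (le_trans (expR_sum_bound M z))// ler_pM ?expR_ge0 ?exprn_ge0//.
  rewrite mulnCA; move: M => n.
  rewrite exprM -exprMn -expr_div_n lerXn2r ?nnegrE ?divr_ge0 ?mulr_ge0 ?exprn_ge0//.
  rewrite normrN normrM (ger0_norm (x := _^-1)) ?invr_ge0//.
  rewrite ler_pM ?invr_ge0// lef_pV2 ?posrE//.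
  by rewrite mulr_natl mulr2n lerDl.
have D : `|expR y - \sum_(m < M) z ^+ m / m`!%:R| <= expR 1 * expR (kap / 8 * p ^+ 2 / t) *
    (C1 * p ^+ (2 * K.+2) / t + C2 ^+ M * p ^+ (2 * (3 * K.+1)) / t ^+ M).
  rewrite mulrDr (le_trans _ (lerD D1 D2))//.
  by rewrite (le_trans _ (ler_normD _ _))// subrKA.
rewrite (le_trans (ler_pM (normr_ge0 _) (expR_ge0 _) D hu))//.
pose E := expR (- (kap / 8 * p ^+ 2 / t)).
have EE : expR (kap / 8 * p ^+ 2 / t) * expR (- (kap / 2 * p ^+ 2 / t)) <= E * E.
  rewrite -!expRD ler_expR -subr_ge0.
  have -> : - (kap / 8 * p ^+ 2 / t) + - (kap / 8 * p ^+ 2 / t) -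
    (kap / 8 * p ^+ 2 / t + - (kap / 2 * p ^+ 2 / t)) = 2 * (kap / 16 * p ^+ 2 / t).
    by field; rewrite gt_eqF.
  by rewrite mulr_ge0.
set X := C1 * _ / t + _.
have X0 : 0 <= X.
  by rewrite /X addr_ge0// divr_ge0 ?exprn_ge0//; apply: mulr_ge0; rewrite ?exprn_ge0.
have W (a b c e : R) : a * b / c * e = a * (b * e / c) by ring.
have XE : X * E <= (C1 * c1 + C2 ^+ M * c2) * t ^+ K.+1.
  rewrite /X mulrDl mulrDl lerD//.
    rewrite W -[leRHS]mulrA ler_wpM2l// ler_pdivrMr// -[leRHS]mulrA -exprSr.
    exact: Hc1.
  rewrite W -[leRHS]mulrA ler_wpM2l ?exprn_ge0// ler_pdivrMr ?exprn_gt0//.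
  rewrite -[leRHS]mulrA -exprD -mulSn.
  exact: Hc2.
rewrite -/E mulrDl mul1r mulrDl ler_wpDr ?mulr_ge0 ?expR_ge0 ?exprn_ge0//.
apply: (@le_trans _ _ (expR 1 * X * (E * E))).
  have -> : expR 1 * expR (kap / 8 * p ^+ 2 / t) * X * expR (- (kap / 2 * p ^+ 2 / t)) =
    expR 1 * X * (expR (kap / 8 * p ^+ 2 / t) * expR (- (kap / 2 * p ^+ 2 / t))).
    by rewrite [expR 1 * _ * X]mulrAC [RHS]mulrA.
  by rewrite ler_wpM2l// mulr_ge0// expR_ge0.
rewrite mulrA ler_wpM2r ?expR_ge0// -[leLHS]mulrA -[leRHS]mulrA.
by rewrite ler_wpM2l ?expR_ge0.
Qed.

Let truncated_term_outer (d C3 : R) L m : 0 < d -> (0 < L)%N ->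
    (forall x, d <= rho x -> `|T x| <= C3 * rho x ^+ (2 * L)) ->
  exists2 C : R, 0 < C & forall t x, 0 < t -> t <= 1 -> d <= rho x ->
    `|(- (T x / (2 * t))) ^+ m / m`!%:R * expR (- (q x / (2 * t)))| <=
    C * t ^+ K.+1 * expR (- (kap / 8 * rho x ^+ 2 / t)).
Proof.
move=> d0 L0 hT; have k4 : 0 < kap / 4 by rewrite divr_gt0.
have [c c0 Hc] := pow_gauss_scaled_even (L * m + K.+1) k4.
exists ((`|C3| + 1) ^+ m * ((d ^+ 2) ^+ K.+1)^-1 * c).
  by rewrite !mulr_gt0 ?invr_gt0 ?exprn_gt0// ltr_wpDl.
move=> t x t0 t1 dx; have t0' := ltW t0.
have p0 : 0 < rho x := lt_le_trans d0 dx.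
have t2 : 0 < 2 * t by rewrite mulr_gt0.
move: (hT x dx) (q_exp x t0).
move: (rho x) (T x) (q x) p0 dx => p v u p0 dp hv hu.
have p0' := ltW p0.
have v1 : `|- (v / (2 * t))| <= (`|C3| + 1) * p ^+ (2 * L) / t.
  rewrite normrN normrM ler_pM//; last first.
    rewrite ger0_norm ?invr_ge0 ?(ltW t2)// lef_pV2 ?posrE//.
    by rewrite mulr_natl mulr2n lerDl.
  rewrite (le_trans hv)// ler_wpM2r ?exprn_ge0//.
  by rewrite (le_trans (ler_norm _))// lerDl.
have B0 : 0 <= (`|C3| + 1) * p ^+ (2 * L) / t.
  by rewrite divr_ge0// mulr_ge0 ?exprn_ge0// addr_ge0.
have v2 : `|(- (v / (2 * t))) ^+ m / m`!%:R| <= ((`|C3| + 1) * p ^+ (2 * L) / t) ^+ m.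
  rewrite normrM normrX -[leRHS]mulr1 ler_pM ?exprn_ge0//.
    by rewrite lerXn2r ?nnegrE.
  rewrite ger0_norm ?invr_ge0// invf_le1 ?ltr0n ?fact_gt0//.
  by rewrite ler1n fact_gt0.
rewrite normrM (ger0_norm (expR_ge0 _)).
apply: (le_trans (ler_pM (normr_ge0 _) (expR_ge0 _) v2 hu)).
pose E := expR (- (kap / 4 * p ^+ 2 / t)).
have EE : expR (- (kap / 2 * p ^+ 2 / t)) = E * E.
  by rewrite -expRD; congr expR; field; rewrite gt_eqF.
have E8 : E <= expR (- (kap / 8 * p ^+ 2 / t)).
  rewrite ler_expR lerN2 ler_pM2r ?invr_gt0// ler_pM2r ?exprn_gt0//.
  by rewrite ler_pM2l// lef_pV2 ?posrE// ler_nat.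
rewrite EE mulrA; apply: ler_pM => //; rewrite ?mulr_ge0 ?exprn_ge0 ?expR_ge0//.
have d2 : 1 <= ((d ^+ 2) ^+ K.+1)^-1 * (p ^+ 2) ^+ K.+1.
  rewrite mulrC ler_pdivlMr ?exprn_gt0// mul1r lerXn2r ?nnegrE ?exprn_ge0//.
    by rewrite ltW.
  by rewrite lerXn2r ?nnegrE// ltW.
have Hct := Hc t p t0 p0'.
rewrite expr_div_n exprMn -(exprM p (2 * L) m) -(mulnA 2 L m).
apply: (@le_trans _ _ ((`|C3| + 1) ^+ m * (((d ^+ 2) ^+ K.+1)^-1 * (p ^+ 2) ^+ K.+1) *
    (p ^+ (2 * (L * m)) * E) / t ^+ m)).
  have W (a b c' f : R) : a * b / c' * f = a * (b * f) / c' by ring.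
  rewrite W ler_pM2r ?invr_gt0 ?exprn_gt0// ler_wpM2r//.
    by apply: mulr_ge0; rewrite ?exprn_ge0 ?expR_ge0.
  by rewrite -[leLHS]mulr1 ler_wpM2l ?exprn_ge0// addr_ge0.
have -> : (`|C3| + 1) ^+ m * (((d ^+ 2) ^+ K.+1)^-1 * (p ^+ 2) ^+ K.+1) *
    (p ^+ (2 * (L * m)) * E) / t ^+ m = (`|C3| + 1) ^+ m * ((d ^+ 2) ^+ K.+1)^-1 *
    (p ^+ (2 * (L * m + K.+1)) * E) / t ^+ m.
  rewrite mulnDr exprD -(exprM p 2 K.+1).
  by move: ((d ^+ 2) ^+ K.+1)^-1 (t ^+ m)^-1 (p ^+ (2 * K.+1)) (p ^+ (2 * (L * m))) => *; ring.
rewrite ler_pdivrMr ?exprn_gt0//.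
apply: (@le_trans _ _ ((`|C3| + 1) ^+ m * ((d ^+ 2) ^+ K.+1)^-1 * (c * t ^+ (L * m + K.+1)))).
  by rewrite ler_wpM2l// mulr_ge0 ?invr_ge0 ?exprn_ge0 ?addr_ge0// ltW.
rewrite -!(mulrA ((`|C3| + 1) ^+ m * ((d ^+ 2) ^+ K.+1)^-1)) -(mulrA c) ler_wpM2l//.
  by rewrite mulr_ge0 ?invr_ge0 ?exprn_ge0 ?addr_ge0// ltW.
rewrite ler_pM2l// -exprD addnC ler_wiXn2l// leq_add2l.
by rewrite leq_pmull.
Qed.

Lemma laplace_outer (d C3 e : R) L : 0 < d -> 0 < e -> (0 < L)%N ->
    (forall x, d <= rho x -> `|T x| <= C3 * rho x ^+ (2 * L)) ->
    (forall x, d <= rho x -> e <= S x) ->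
  exists2 C : R, 0 < C & forall t x, 0 < t -> t <= 1 -> d <= rho x ->
    `|expR (- (S x / (2 * t))) - truncated_exp t x| <=
    C * t ^+ K.+1 * expR (- (kap / 8 * rho x ^+ 2 / t)) +
    C * t ^+ K.+2 * expR (- (4^-1 * S x)).
Proof.
move=> d0 e0 L0 hT hS.
have [C C0 HC] : exists2 C : R, 0 < C & forall t x, 0 < t -> t <= 1 -> d <= rho x ->
    `|truncated_exp t x| <= C * t ^+ K.+1 * expR (- (kap / 8 * rho x ^+ 2 / t)).
  rewrite /truncated_exp; elim: (2 * K.+1)%N => [|n [C C0 HC]].
    exists 1 => // t x t0 _ _; rewrite big_ord0 mul0r normr0.
    by rewrite !mulr_ge0 ?expR_ge0// exprn_ge0// ltW.
  have [c c0 Hc] := truncated_term_outer n d0 L0 hT.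
  exists (C + c) => [|t x t0 t1 dx]; first exact: addr_gt0.
  rewrite big_ord_recr /= mulrDl (le_trans (ler_normD _ _))//.
  rewrite -[leRHS]mulrA [leRHS]mulrDl !(mulrA _ _ (expR (- (kap / 8 * rho x ^+ 2 / t)))).
  by apply: lerD; [exact: HC|exact: Hc].
have e4 : 0 < e / 4 by rewrite divr_gt0.
have [c c0 Hc] := pow_gauss_scaled_even K.+2 e4.
exists (C + c); first exact: addr_gt0.
move=> t x t0 t1 dx; have t0' := ltW t0.
rewrite (le_trans (ler_normB _ _))// addrC lerD//.
  rewrite (le_trans (HC _ _ t0 t1 dx))// ler_wpM2r ?expR_ge0// ler_wpM2r ?exprn_ge0//.
  by rewrite lerDl ltW.
rewrite ger0_norm ?expR_ge0//.
have := Hc t 1 t0 ler01; rewrite !expr1n mul1r mulr1 => Hct.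
apply: (@le_trans _ _ (expR (- (e / 4 / t)) * expR (- (4^-1 * S x)))).
  rewrite -expRD ler_expR -opprD lerN2.
  have eS := hS x dx; have S0 : 0 <= S x by rewrite (le_trans _ eS)// ltW.
  have -> : S x / (2 * t) = S x / 4 / t + 4^-1 * (S x / t) by field; rewrite gt_eqF.
  rewrite lerD//.
    by rewrite ler_pM2r ?invr_gt0// ler_pM2r ?invr_gt0.
  by rewrite ler_pM2l ?invr_gt0// ler_peMr// invf_ge1.
rewrite ler_wpM2r ?expR_ge0// (le_trans Hct)// ler_wpM2r ?exprn_ge0//.
by rewrite lerDr ltW.
Qed.

End LaplaceEstimate.

(** * Term-by-term integration *)

Section JetExpansions.
Context {R : realType}.
Implicit Types (f : plane R -> R) (x xi : plane R) (t : R).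
Local Notation area := (@lebesgue_measure R \x @lebesgue_measure R)%E.

(* [(c, (a, b), m)] stands for the monomial [c * h_1^a * h_2^b * t^-m]. *)
Definition jet_term n : Type := (jet_poly (R := R) n * (nat * nat) * nat)%type.

Definition jet_term_eval n f xi t x (e : jet_term n) : R :=
  jet_eval e.1.1 f xi * monomial e.1.2.1 e.1.2.2 xi x / t ^+ e.2.

(* The pairing with the Gaussian weight turns such a term into a multiple of
   [t ^ ((a + b) / 2 - m)], so this condition excludes negative powers of [t]. *)
Definition jet_term_ok n (e : jet_term n) := (2 * e.2 <= e.1.2.1 + e.1.2.2)%N.

Definition expandable n (F : (plane R -> R) -> plane R -> R -> plane R -> R) :=
  exists2 l : seq (jet_term n), all (@jet_term_ok n) l & forall f xi t x,
    0 < t -> F f xi t x = \sum_(e <- l) jet_term_eval f xi t x e.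

Lemma expandable_term n (e : jet_term n) : jet_term_ok e ->
  expandable n (fun f xi t x => jet_term_eval f xi t x e).
Proof. by move=> ok; exists [:: e] => [|f xi t x _]; rewrite /= ?ok// big_seq1. Qed.

Lemma expandable_cst n (c : R) : expandable n (fun _ _ _ _ => c).
Proof.
exists [:: (jet_C n c, (0%N, 0%N), 0%N)] => // f xi t x _.
by rewrite big_seq1 /jet_term_eval /= jet_evalC /monomial !expr0 !mulr1 divr1.
Qed.

Lemma expandableD n F G : expandable n F -> expandable n G ->
  expandable n (fun f xi t x => F f xi t x + G f xi t x).
Proof.
move=> [l lok Fl] [k kok Gk]; exists (l ++ k); first by rewrite all_cat lok.
by move=> f xi t x t0; rewrite big_cat Fl// Gk.
Qed.

Lemma expandableM n F G : expandable n F -> expandable n G ->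
  expandable n (fun f xi t x => F f xi t x * G f xi t x).
Proof.
move=> [l lok Fl] [k kok Gk].
pose prd (e e' : jet_term n) : jet_term n := (e.1.1 * e'.1.1,
  ((e.1.2.1 + e'.1.2.1)%N, (e.1.2.2 + e'.1.2.2)%N), (e.2 + e'.2)%N).
exists [seq prd e e' | e <- l, e' <- k].
  apply/allP => _ /allpairsP[[e e'] /= [el ek ->]].
  have := allP lok _ el; have := allP kok _ ek; rewrite /jet_term_ok /=.
  by move=> h h'; rewrite mulnDr addnACA leq_add.
move=> f xi t x t0; rewrite Fl// Gk// big_distrlr/= big_allpairs_dep.
apply: eq_bigr => e _; apply: eq_bigr => e' _.
rewrite /jet_term_eval /prd /monomial /= jet_evalM !exprD invfM.
move: (jet_eval e.1.1 f xi) (jet_eval e'.1.1 f xi) (t ^+ e.2)^-1 (t ^+ e'.2)^-1.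
move: (_ ^+ e.1.2.1) (_ ^+ e.1.2.2) (_ ^+ e'.1.2.1) (_ ^+ e'.1.2.2) => a b a' b' c c' u v.
by ring.
Qed.

Lemma expandable_sum n (I : Type) (r : seq I) (p : pred I) F :
    (forall i, p i -> expandable n (F i)) ->
  expandable n (fun f xi t x => \sum_(i <- r | p i) F i f xi t x).
Proof.
move=> HF; elim: r => [|i r IH].
  exists [::] => // f xi t x _; by rewrite !big_nil.
have [pi|pi] := boolP (p i).
  have [l lok Hl] := expandableD (HF i pi) IH; exists l => // f xi t x t0.
  by rewrite big_cons pi Hl.
have [l lok Hl] := IH; exists l => // f xi t x t0.
by rewrite big_cons (negbTE pi) Hl.
Qed.

Lemma expandableX n F m : expandable n F ->
  expandable n (fun f xi t x => F f xi t x ^+ m).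
Proof.
move=> HF; elim: m => [|m IH].
  exact: expandable_cst n 1.
have [l lok Hl] := expandableM HF IH; exists l => // f xi t x t0.
by rewrite exprS Hl.
Qed.

Lemma group_powers (I : Type) (r : seq I) (p : pred I) (d : I -> nat) (v : I -> R) K :
  exists2 C : R, 0 <= C & forall t, 0 < t -> t <= 1 ->
  `|\sum_(i <- r | p i) t ^+ d i * v i -
    \sum_(k < K.+1) t ^+ k * \sum_(i <- r | p i && (d i == k)) v i| <= C * t ^+ K.+1.
Proof.
elim: r => [|i r [C C0 HC]].
  exists 0 => // t _ _; rewrite big_nil big1 ?subr0 ?normr0 ?mul0r// => k _.
  by rewrite big_nil mulr0.
have [pi|pi] := boolP (p i); last first.
  exists C => // t t0 t1; rewrite big_cons (negbTE pi).
  rewrite [X in _ - X](eq_bigr (fun k : 'I_K.+1 =>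
    t ^+ k * \sum_(j <- r | p j && (d j == k)) v j)); first exact: HC.
  by move=> k _; rewrite big_cons (negbTE pi).
exists (C + `|v i|) => [|t t0 t1]; first by rewrite addr_ge0.
rewrite big_cons pi.
have -> : \sum_(k < K.+1) t ^+ k * \sum_(j <- i :: r | p j && (d j == k)) v j =
    (if (d i < K.+1)%N then t ^+ d i * v i else 0) +
    \sum_(k < K.+1) t ^+ k * \sum_(j <- r | p j && (d j == k)) v j.
  have -> : (if (d i < K.+1)%N then t ^+ d i * v i else 0) =
      \sum_(k < K.+1) (if d i == k then t ^+ k * v i else 0).
    case: ltnP => dK.
      rewrite (bigD1 (Ordinal dK))//= eqxx big1 ?addr0// => k /negP kd.
      by case: eqP => // E; case: kd; apply/eqP/val_inj.
    rewrite big1// => k _; case: eqP => // E.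
    by have := ltn_ord k; rewrite -E ltnNge dK.
  rewrite -big_split; apply: eq_bigr => k _; rewrite big_cons pi /=.
  by case: eqP => _; rewrite ?mulrDr ?add0r.
set X := (if _ then _ else _); set A := \sum_(j <- r | _) _; set B := \sum_(k < _) _.
have -> : t ^+ d i * v i + A - (X + B) = (A - B) + (t ^+ d i * v i - X) by ring.
rewrite (le_trans (ler_normD _ _))// mulrDl lerD ?HC// /X.
case: ltnP => dK; first by rewrite subrr normr0 mulr_ge0// exprn_ge0// ltW.
rewrite subr0 normrM mulrC ler_wpM2l// normrX ger0_norm ?(ltW t0)//.
by rewrite ler_wiXn2l// ltW.
Qed.

Definition jet_gauss f xi t x : R :=
  expR (- quad (hessian f xi 0 0 / (4 * t)) (hessian f xi 0 1 / (4 * t))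
    (hessian f xi 1 1 / (4 * t)) xi x).

Lemma jet_terms_gauss_integral n (l : seq (jet_term n)) f xi t :
    hess_posdef f xi -> 0 < t ->
  let G x := (\sum_(e <- l) jet_term_eval f xi t x e) * jet_gauss f xi t x in
  [/\ continuous G, gauss_dominated xi G & \int[area]_x G x =
    \sum_(e <- l) jet_eval e.1.1 f xi / t ^+ e.2 * hess_moment f xi t e.1.2.1 e.1.2.2].
Proof.
move=> pd t0 /=; have [h d] := hess_scaled_posdef pd t0.
elim: l => [|e l [cG gG iG]].
  have E : (fun x => (\sum_(e <- [::]) jet_term_eval (n := n) f xi t x e) * jet_gauss f xi t x) = fun=> 0.
    by apply/funext => x; rewrite big_nil mul0r.
  rewrite E big_nil; split.
  - by move=> x; exact: cvg_cst.
  - exists 1, 1; split => // x; rewrite normr0 mul1r; exact: expR_ge0.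
  - by rewrite /Rintegral integral0.
pose k := jet_eval e.1.1 f xi / t ^+ e.2.
pose G0 x := monomial e.1.2.1 e.1.2.2 xi x * jet_gauss f xi t x.
have cG0 : continuous G0 by exact: continuous_monomial_gauss.
have gG0 : gauss_dominated xi G0 by exact: monomial_gauss_dominated.
have E : (fun x => (\sum_(e' <- e :: l) jet_term_eval f xi t x e') * jet_gauss f xi t x) =
   fun x => k * G0 x + (\sum_(e <- l) jet_term_eval f xi t x e) * jet_gauss f xi t x.
  apply/funext => x; rewrite big_cons mulrDl; congr (_ + _).
  by rewrite /jet_term_eval /k /G0; ring.
have ckG0 : continuous (fun x => k * G0 x).
  by move=> x; apply: cvgM; [exact: cvg_cst|exact: cG0].
have gkG0 := gauss_dominatedM k gG0.
rewrite E; split.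
- by move=> x; apply: cvgD; [exact: ckG0|exact: cG].
- exact: gauss_dominatedD.
- rewrite (@Rintegral_gaussD _ xi)// iG big_cons; congr (_ + _).
  by rewrite RintegralZl//; exact: (gauss_dominated_integrable cG0 gG0).
Qed.

Lemma expandable_gauss_integral n F K : expandable n F ->
  exists B : nat -> jet_poly n, forall f xi, hess_posdef f xi ->
  (forall t, 0 < t -> area.-integrable setT
     (EFin \o (fun x => F f xi t x * jet_gauss f xi t x))) /\
  exists2 C : R, 0 <= C & forall t, 0 < t -> t <= 1 ->
    `|(4 * pi * t)^-1 * \int[area]_x (F f xi t x * jet_gauss f xi t x) -
      \sum_(k < K.+1) t ^+ k * laplace_coef (B k) f xi| <= C * t ^+ K.+1.
Proof.
move=> [l lok Fl].
pose W (a b : nat) := projT1 (cid (@hess_moment_jet_poly R n a b)).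
have HW a b f xi t : hess_posdef f xi -> 0 < t -> hess_moment f xi t a b =
    even_pow t (a + b) * jet_eval (W a b) f xi * hess_moment f xi t 0 0.
  exact: (projT2 (cid (@hess_moment_jet_poly R n a b))).
pose ev (e : jet_term n) := ~~ odd (e.1.2.1 + e.1.2.2).
pose dg (e : jet_term n) := ((e.1.2.1 + e.1.2.2)./2 - e.2)%N.
pose cf (e : jet_term n) : jet_poly n := e.1.1 * W e.1.2.1 e.1.2.2.
exists (fun k => \sum_(e <- l | ev e && (dg e == k)) cf e) => f xi pd.
have FG t : 0 < t -> (fun x => F f xi t x * jet_gauss f xi t x) =
    (fun x => (\sum_(e <- l) jet_term_eval f xi t x e) * jet_gauss f xi t x).
  by move=> t0; apply/funext => x; rewrite Fl.
split=> [t t0|].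
  rewrite FG//; have [cG gG _] := jet_terms_gauss_integral l pd t0.
  exact: (gauss_dominated_integrable cG gG).
have [C C0 HC] := group_powers l ev dg (fun e => jet_eval (cf e) f xi) K.
pose D := Num.sqrt (\det (invmx (hessian f xi))).
have D0 : 0 <= D by exact: sqrtr_ge0.
exists (D * C) => [|t t0 t1]; first exact: mulr_ge0.
have [_ _ iG] := jet_terms_gauss_integral l pd t0.
have -> : \int[area]_x (F f xi t x * jet_gauss f xi t x) = 4 * pi * t * D *
    \sum_(e <- l | ev e) t ^+ dg e * jet_eval (cf e) f xi.
  rewrite FG// iG mulr_sumr [RHS]big_mkcond [LHS]big_seq [RHS]big_seq.
  apply: eq_bigr => e el; have := allP lok e el; rewrite /jet_term_ok => eok.
  rewrite (HW _ _ _ _ _ pd t0) hess_moment00// -/D /even_pow /ev /dg /cf jet_evalM.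
  case: odd => /=; first by rewrite !mul0r mulr0.
  have -> : t ^+ (e.1.2.1 + e.1.2.2)./2 =
      t ^+ ((e.1.2.1 + e.1.2.2)./2 - e.2) * t ^+ e.2.
    rewrite -exprD subnK//.
    by rewrite -(doubleK e.2) half_leq// -mul2n.
  have te : t ^+ e.2 != 0 by rewrite expf_neq0// gt_eqF.
  by move: (t ^+ (_ - _)) (t ^+ e.2) te => u w w0; field.
have pt0 : 4 * pi * t != 0 :> R by rewrite gt_eqF// !mulr_gt0// pi_gt0.
rewrite -(mulrA (4 * pi * t)) mulKf//.
rewrite (eq_bigr (fun k : 'I_K.+1 => D *
  (t ^+ k * \sum_(e <- l | ev e && (dg e == k)) jet_eval (cf e) f xi))); last first.
  by move=> k _; rewrite /laplace_coef jet_eval_sum mulrCA.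
rewrite -mulr_sumr -mulrBr normrM (ger0_norm D0) -mulrA ler_wpM2l//.
exact: HC.
Qed.

End JetExpansions.

Section TaylorTail.
Context {R : realType}.
Implicit Types (f : plane R -> R) (x xi : plane R) (t : R).

Definition taylor_tail N f xi x : R :=
  \sum_(b < N) \sum_(a < N - b | (3 <= a + b)%N) taylor_coef f xi a b * monomial a b xi x.

Lemma sum_low_degree N (F : nat -> nat -> R) :
  \sum_(b < N.+3) \sum_(a < N.+3 - b | ~~ (3 <= a + b)%N) F a b =
  F 0%N 0%N + F 1%N 0%N + F 2%N 0%N + F 0%N 1%N + F 1%N 1%N + F 0%N 2%N.
Proof.
rewrite 3!big_ord_recl /= /bump /= !subSS !subn0.
rewrite [X in _ + (_ + (_ + X))]big1 => [|b _]; last first.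
  by rewrite big1// => a /negP[]; apply: leq_trans (leq_addl _ _).
have row0 : \sum_(a < N.+3 | ~~ (3 <= a + 0)%N) F a 0%N = F 0%N 0%N + (F 1%N 0%N + F 2%N 0%N).
  rewrite big_mkcond 3!big_ord_recl /= /bump /= big1 ?addr0 //.
have row1 : \sum_(a < N.+2 | ~~ (3 <= a + 1)%N) F a 1%N = F 0%N 1%N + F 1%N 1%N.
  rewrite big_mkcond 2!big_ord_recl /= /bump /= big1 ?addr0// => a _.
  by rewrite addn1.
have row2 : \sum_(a < N.+1 | ~~ (3 <= a + 2)%N) F a 2%N = F 0%N 2%N.
  rewrite big_mkcond big_ord_recl /= /bump /= big1 ?addr0// => a _.
  by rewrite addn2.
rewrite row0 [X in _ + (X + _)]row1 [X in _ + (_ + (X + _))]row2 addr0 !addrA //.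
Qed.

Lemma taylor_tail_le N f xi : exists2 C : R, 0 <= C & forall x (m : R),
  (forall j, (3 <= j <= N)%N -> dist xi x ^+ j <= m) -> `|taylor_tail N f xi x| <= C * m.
Proof.
exists (\sum_(b < N) \sum_(a < N - b | (3 <= a + b)%N) `|taylor_coef f xi a b|).
  by apply: sumr_ge0 => b _; exact: sumr_ge0.
move=> x m hm; rewrite (le_trans (ler_norm_sum _ _ _))// mulr_suml ler_sum// => b _.
rewrite (le_trans (ler_norm_sum _ _ _))// mulr_suml ler_sum// => a ab.
rewrite normrM ler_wpM2l// (le_trans (monomial_le _ _ _ _))// hm// ab /=.
by rewrite addnC -leq_subRL ltnW.
Qed.

Lemma expandable_ext n (F G : (plane R -> R) -> plane R -> R -> plane R -> R) :
  (forall f xi t x, 0 < t -> F f xi t x = G f xi t x) -> expandable n F -> expandable n G.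
Proof. by move=> FG [l lok Fl]; exists l => // f xi t x t0; rewrite -FG// Fl. Qed.

Lemma expandable_truncated_exp N M : expandable N (fun f xi t x =>
  \sum_(m < M) (- (taylor_tail N f xi x / (2 * t))) ^+ m / m`!%:R).
Proof.
apply: expandable_sum => m _; apply: expandableM; last exact: expandable_cst.
apply: expandableX.
pose e (b : 'I_N) (a : 'I_(N - b)) : jet_term (R := R) N :=
  (jet_C N (- (2 * (a`!%:R * b`!%:R))^-1) * jet_X (inl (widen_ord (leq_subr b N) a, b)),
   (nat_of_ord a, nat_of_ord b), 1%N).
apply: (@expandable_ext _ (fun f xi t x =>
  \sum_(b < N) \sum_(a < N - b | (3 <= a + b)%N) jet_term_eval f xi t x (e b a))).
  move=> f xi t x t0; rewrite /taylor_tail mulr_suml -sumrN; apply: eq_bigr => b _.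
  rewrite mulr_suml -sumrN; apply: eq_bigr => a _.
  rewrite /jet_term_eval /e /= jet_evalM jet_evalC jet_evalX /jet_value /= expr1.
  rewrite /taylor_coef /mixed_partial !invfM.
  move: (iter_partial _ _ _) (monomial _ _ _ _) (a`!%:R)^-1 (b`!%:R)^-1 => u v w z.
  by ring.
apply: expandable_sum => b _; apply: expandable_sum => a ab.
apply: expandable_term; rewrite /jet_term_ok /e /= muln1.
by rewrite (leq_trans _ ab).
Qed.

End TaylorTail.

Section TraceExpansion.
Context {R : realType}.
Implicit Types (x xi : plane R) (t : R) (S : plane R -> R).
Local Notation area := (@lebesgue_measure R \x @lebesgue_measure R)%E.

Definition half_hessian_form S xi x : R :=
  quad (hessian S xi 0 0 / 2) (hessian S xi 0 1 / 2) (hessian S xi 1 1 / 2) xi x.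

Lemma taylor_split S xi N : S xi = 0 -> (forall i, partial i S xi = 0) -> forall x,
  \sum_(b < N.+3) \sum_(a < N.+3 - b) taylor_coef S xi a b * monomial a b xi x =
  half_hessian_form S xi x + taylor_tail N.+3 S xi x.
Proof.
have coefE (a b c u v w : R) : a / 2 * u + b / 1 * v + c / 2 * w =
    a / 2 * u + 2 * (b / 2) * v + c / 2 * w by field.
move=> S0 dS x; pose F a b := taylor_coef S xi a b * monomial a b xi x.
transitivity (\sum_(b < N.+3) \sum_(a < N.+3 - b | ~~ (3 <= a + b)%N) F a b +
    taylor_tail N.+3 S xi x).
  rewrite /taylor_tail -big_split; apply: eq_bigr => b _.
  by rewrite (bigID (fun a : 'I__ => (3 <= a + b)%N)) /= addrC.
rewrite sum_low_degree; congr (_ + _); rewrite /F /taylor_coef /mixed_partial /=.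
rewrite /iter_partial /= !dS S0 /half_hessian_form quadE !mxE !mul0r !add0r.
rewrite !fact0 !factS fact0 !mulr1 !mul1r !muln1 addr0.
exact: coefE.
Qed.

Lemma integral_gauss_dist xi (c : R) : 0 < c ->
  [/\ continuous (fun x => expR (- (c * dist xi x ^+ 2))),
      gauss_dominated xi (fun x => expR (- (c * dist xi x ^+ 2))) &
      \int[area]_x expR (- (c * dist xi x ^+ 2)) = pi / c].
Proof.
move=> c0; have E : (fun x => expR (- (c * dist xi x ^+ 2))) =
    (fun x => expR (- quad c 0 c xi x)).
  by apply/funext => x; rewrite dist_sqr /sqdist /quad; congr (expR (- _)); ring.
have cc : 0 < c * c - 0 ^+ 2 by rewrite expr0n subr0 mulr_gt0.
split.
- by rewrite E; exact: continuous_gauss_weight.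
- exists 1, c; split => // x.
  by rewrite ger0_norm ?expR_ge0// mul1r dist_sqr.
- rewrite E /Rintegral integral_gauss_weight//= expr0n subr0 -expr2 sqrtr_sqr.
  by rewrite gtr0_norm.
Qed.

Lemma laplace_integral_estimate S xi (G : R -> plane R -> R) (c C : R) K :
    0 < c -> 0 <= C -> continuous S -> (forall x, 0 <= S x) -> grows S ->
    (forall t, 0 < t -> area.-integrable setT (EFin \o G t)) ->
    (forall t x, 0 < t -> t <= 1 -> `|expR (- (S x / (2 * t))) - G t x| <=
      C * t ^+ K.+1 * expR (- (c * dist xi x ^+ 2 / t)) +
      C * t ^+ K.+2 * expR (- (4^-1 * S x))) ->
  exists2 D : R, 0 <= D & forall t, 0 < t -> t <= 1 ->
    `|\int[area]_x expR (- (S x / (2 * t))) - \int[area]_x G t x| <= D * t ^+ K.+2.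
Proof.
move=> c0 C0 cS S0 gS iG H.
pose I : R := \int[area]_x expR (- (4^-1 * S x)).
have I0 : 0 <= I by apply: Rintegral_ge0 => x _; exact: expR_ge0.
have c0' := ltW c0.
exists (C * (pi / c) + C * I).
  by rewrite addr_ge0// mulr_ge0// divr_ge0// pi_ge0.
move=> t t0 t1.
have iE : area.-integrable setT (EFin \o (fun x => expR (- (S x / (2 * t))))).
  have tau0 : 0 < (2 * t)^-1 by rewrite invr_gt0 mulr_gt0.
  have := grows_integrable tau0 S0 cS gS.
  by congr (_.-integrable _ _); apply/funext => x /=; rewrite mulrC.
have iS : area.-integrable setT (EFin \o (fun x => expR (- (4^-1 * S x)))).
  by apply: grows_integrable => //; rewrite invr_gt0.
have ct0 : 0 < c / t by rewrite divr_gt0.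
have [cg gg vg] := integral_gauss_dist xi ct0.
have ig := gauss_dominated_integrable cg gg.
pose k1 := C * t ^+ K.+1; pose k2 := C * t ^+ K.+2.
have i1 : area.-integrable setT (EFin \o (fun x => k1 * expR (- (c / t * dist xi x ^+ 2)))).
  exact: (integrableZl measurableT k1 ig).
have i2 : area.-integrable setT (EFin \o (fun x => k2 * expR (- (4^-1 * S x)))).
  exact: (integrableZl measurableT k2 iS).
have i12 : area.-integrable setT (EFin \o (fun x => k1 * expR (- (c / t * dist xi x ^+ 2)) +
    k2 * expR (- (4^-1 * S x)))).
  exact: (integrableD measurableT i1 i2).
have iD : area.-integrable setT (EFin \o (fun x => expR (- (S x / (2 * t))) - G t x)).
  exact: (integrableB measurableT iE (iG t t0)).
rewrite -RintegralB//; last exact: iG.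
apply: (le_trans (le_normr_Rintegral measurableT iD)).
apply: (@le_trans _ _ (\int[area]_x (k1 * expR (- (c / t * dist xi x ^+ 2)) +
    k2 * expR (- (4^-1 * S x))))).
  apply: le_Rintegral => //.
    have -> : EFin \o (fun x => `|expR (- (S x / (2 * t))) - G t x|) =
        abse \o (EFin \o (fun x => expR (- (S x / (2 * t))) - G t x)) by [].
    exact: (integrable_abse iD).
  move=> x _; have := H t x t0 t1.
  by rewrite /k1 /k2 [c / t * _]mulrAC.
rewrite RintegralD// !RintegralZl// vg -/I /k1 /k2 [t ^+ K.+2]exprSr.
rewrite le_eqVlt; apply/orP; left; apply/eqP.
by move: (t ^+ K.+1) => u; field; rewrite !gt_eqF.
Qed.

End TraceExpansion.

(** * The expansion *)

Section Main.
Context {R : realType}.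
Implicit Types (Phi : plane R -> plane R) (x xi : plane R) (t : R).
Local Notation area := (@lebesgue_measure R \x @lebesgue_measure R)%E.

Lemma half_hessian_form_jet_gauss S xi t x : 0 < t ->
  expR (- (half_hessian_form S xi x / (2 * t))) = jet_gauss S xi t x.
Proof.
by move=> t0; congr (expR (- _)); rewrite /half_hessian_form /quad; field; rewrite gt_eqF.
Qed.

Lemma heat_kernel_integrand Phi t : (fun x => heat_kernel t (Phi x) x) =
  (fun x => (4 * pi * t)^-1 * expR (- (displacement Phi x / (2 * t)))).
Proof. by []. Qed.

Lemma displacement_integrable Phi xi t : smooth_map Phi -> fixed_points Phi = [set xi] ->
    grows (displacement Phi) -> 0 < t ->
  area.-integrable setT (EFin \o (fun x => expR (- (displacement Phi x / (2 * t))))).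
Proof.
move=> sPhi fPhi gS t0.
have tau0 : 0 < (2 * t)^-1 by rewrite invr_gt0 mulr_gt0.
have := grows_integrable tau0 (displacement_ge0 Phi)
  (smooth_continuous (smooth_displacement sPhi)) gS.
by congr (_.-integrable _ _); apply/funext => x /=; rewrite mulrC.
Qed.

Lemma laplace_trace_estimate Phi xi K : smooth_map Phi -> fixed_points Phi = [set xi] ->
    grows (displacement Phi) -> nondegenerate_critical_point (displacement Phi) xi ->
    let S := displacement Phi in
    let G t x := (\sum_(m < 2 * K.+1)
      (- (taylor_tail (2 * K.+2) S xi x / (2 * t))) ^+ m / m`!%:R) * jet_gauss S xi t x in
    (forall t, 0 < t -> area.-integrable setT (EFin \o G t)) ->
  exists2 D : R, 0 <= D & forall t, 0 < t -> t <= 1 ->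
    `|\int[area]_x expR (- (S x / (2 * t))) - \int[area]_x G t x| <= D * t ^+ K.+2.
Proof.
move=> sPhi fPhi gS ndg S G iG.
have sS := smooth_displacement sPhi.
have S0 := displacement_ge0 Phi.
have Sxi := displacement_fixed fPhi.
have cS := smooth_continuous sS.
have pd := hess_posdef_displacement sPhi fPhi ndg; have [sym h0 d0] := pd.
set q := half_hessian_form S xi; set T := taylor_tail (2 * K.+2) S xi.
have [kap kap0 q_ge] : exists2 kap : R, 0 < kap & forall x, kap * sqdist xi x <= q x.
  have A0 : 0 < hessian S xi 0 0 / 2 by rewrite divr_gt0.
  have D0 : 0 < hessian S xi 0 0 / 2 * (hessian S xi 1 1 / 2) - (hessian S xi 0 1 / 2) ^+ 2.
    have -> : hessian S xi 0 0 / 2 * (hessian S xi 1 1 / 2) - (hessian S xi 0 1 / 2) ^+ 2 =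
      hess_det S xi / 4 by rewrite /hess_det; field.
    by rewrite divr_gt0.
  have AD : 0 < hessian S xi 0 0 / 2 + hessian S xi 1 1 / 2.
    rewrite addr_gt0// -(pmulr_rgt0 _ A0) (lt_le_trans D0)//.
    by rewrite lerBlDr lerDl sqr_ge0.
  exists ((hessian S xi 0 0 / 2 * (hessian S xi 1 1 / 2) - (hessian S xi 0 1 / 2) ^+ 2) /
    (hessian S xi 0 0 / 2 + hessian S xi 1 1 / 2)); first exact: divr_gt0.
  by move=> x; exact: quad_ge.
have [C1 [r0 [C10 r00 HT]]] := taylor_plane xi (2 * K.+2) sS.
have split x : \sum_(b < 2 * K.+2) \sum_(a < 2 * K.+2 - b) taylor_coef S xi a b *
    monomial a b xi x = q x + T x.
  rewrite /q /T (_ : (2 * K.+2)%N = (2 * K).+1.+3); last by rewrite !mulnS.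
  by apply: taylor_split => // i; case: ndg.
have [C2 C20 HT2] := taylor_tail_le (2 * K.+2) S xi.
have hS x : dist xi x < r0 -> `|S x - (q x + T x)| <= C1 * dist xi x ^+ (2 * K.+2).
  move=> xr; rewrite -split; apply: HT.
    by rewrite (le_lt_trans (le_dist1 _ _)).
  by rewrite (le_lt_trans (le_dist2 _ _)).
have hT x : dist xi x <= 1 -> `|T x| <= C2 * dist xi x ^+ 3.
  move=> x1; apply: HT2 => j /andP[j3 _].
  by rewrite ler_wiXn2l// dist_ge0.
have [d [Ci [dp d1 Ci0 Hin]]] := laplace_inner kap0 q_ge C10 C20 r00 hS hT.
have S00 x : S x = 0 -> x = xi := @displacement_eq0 _ _ _ fPhi x.
have [e e0 He] := grows_away dp S0 S00 cS gS.
pose L := (2 * K.+2)%N; pose C3 := C2 * (d ^+ (2 * L))^-1.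
have hTout x : d <= dist xi x -> `|T x| <= C3 * dist xi x ^+ (2 * L).
  move=> dx; rewrite /C3 -mulrA; apply: HT2 => j /andP[_ jL].
  rewrite mulrC ler_pdivlMr ?exprn_gt0//.
  have jL2 : (j <= 2 * L)%N by rewrite (leq_trans jL)// leq_pmull.
  rewrite -[in leRHS](subnKC jL2) exprD ler_wpM2l ?exprn_ge0 ?dist_ge0//.
  apply: (@le_trans _ _ (d ^+ (2 * L - j))).
    by rewrite ler_wiXn2l// ?leq_subr// ltW.
  by rewrite lerXn2r ?nnegrE ?dist_ge0// ltW.
have L0 : (0 < L)%N by [].
have [Co Co0 Hout] := laplace_outer K kap0 q_ge dp e0 L0 hTout He.
have k8 : 0 < kap / 8 by rewrite divr_gt0.
have CC0 : 0 <= Ci + Co by rewrite addr_ge0// ltW.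
apply: (laplace_integral_estimate k8 CC0 cS S0 gS iG) => t x t0 t1.
have -> : G t x = truncated_exp q T K t x.
  by rewrite /G /truncated_exp half_hessian_form_jet_gauss.
have mono (a b u v : R) : a <= b -> 0 <= u -> 0 <= v -> a * u * v <= b * u * v.
  by move=> ab u0 v0; rewrite ler_wpM2r// ler_wpM2r.
have tK n : 0 <= t ^+ n by rewrite exprn_ge0// ltW.
have [xd|dx] := ltP (dist xi x) d.
  apply: (le_trans (Hin t x t0 xd)); apply: ler_wpDr.
    by rewrite mulr_ge0 ?expR_ge0// mulr_ge0.
  by apply: mono; rewrite ?expR_ge0 ?lerDl ?(ltW Co0).
apply: (le_trans (Hout t x t0 t1 dx)); apply: lerD.
  by apply: mono; rewrite ?expR_ge0 ?lerDr ?(ltW Ci0).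
by apply: mono; rewrite ?expR_ge0 ?lerDr ?(ltW Ci0).
Qed.

Lemma trace_expansion K : exists B : nat -> jet_poly (R := R) (2 * K.+2),
  forall Phi xi, smooth_map Phi -> fixed_points Phi = [set xi] ->
    grows (displacement Phi) -> nondegenerate_critical_point (displacement Phi) xi ->
  exists2 C : R, 0 <= C & forall t, 0 < t -> t <= 1 ->
    `|deformed_heat_trace Phi t -
      \sum_(k < K.+1) t ^+ k * laplace_coef (B k) (displacement Phi) xi| <= C * t ^+ K.+1.
Proof.
have [B HB] := expandable_gauss_integral K
  (@expandable_truncated_exp R (2 * K.+2) (2 * K.+1)).
exists B => Phi xi sPhi fPhi gS ndg.
have [iG [C C0 HC]] := HB _ _ (hess_posdef_displacement sPhi fPhi ndg).
have [D D0 HD] := laplace_trace_estimate sPhi fPhi gS ndg iG.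
exists ((4 * pi)^-1 * D + C) => [|t t0 t1].
  by rewrite addr_ge0// mulr_ge0// invr_ge0 mulr_ge0// pi_ge0.
have iE := displacement_integrable sPhi fPhi gS t0.
have pt0 : 0 < 4 * pi * t :> R by rewrite !mulr_gt0// pi_gt0.
rewrite /deformed_heat_trace heat_kernel_integrand RintegralZl//.
have := HC t t0 t1; have := HD t t0 t1.
set I := Rintegral _ _ _; set J := Rintegral _ _ _; set Z := \sum_(k < _) _ => h1 h2.
have -> : (4 * pi * t)^-1 * I - Z = (4 * pi * t)^-1 * (I - J) + ((4 * pi * t)^-1 * J - Z).
  by ring.
rewrite (le_trans (ler_normD _ _))// [leRHS]mulrDl lerD// normrM.
rewrite ger0_norm ?invr_ge0 ?(ltW pt0)//.
apply: (@le_trans _ _ ((4 * pi * t)^-1 * (D * t ^+ K.+2))).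
  by rewrite ler_wpM2l// invr_ge0 ltW.
rewrite exprS le_eqVlt; apply/orP; left; apply/eqP.
have p0 := pi_gt0 R; move: (t ^+ K.+1) (@pi R) p0 => u p p0.
by field; rewrite (gt_eqF t0) (gt_eqF p0).
Qed.

Lemma sum_ord_split (F : nat -> R) k K : (k <= K)%N ->
  \sum_(i < K.+1) F i = \sum_(i < k.+1) F i + \sum_(i < K - k) F (k.+1 + i)%N.
Proof. by move=> kK; rewrite -[in LHS](subnKC kK) -addSn big_split_ord. Qed.

Lemma coef_eq0 n (c : nat -> R) (C : R) :
    (forall t, 0 < t -> t <= 1 -> `|\sum_(k < n) t ^+ k * c k| <= C * t ^+ n) ->
  forall k, (k < n)%N -> c k = 0.
Proof.
elim: n c C => // n IH c C Hc.
have C0 : 0 <= C.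
  by have := le_trans (normr_ge0 _) (Hc 1 ltr01 (lexx _)); rewrite expr1n mulr1.
pose D := C + \sum_(k < n) `|c k.+1|.
have D0 : 0 <= D by rewrite addr_ge0// sumr_ge0.
have split t : \sum_(k < n.+1) t ^+ k * c k = c 0%N + t * \sum_(k < n) t ^+ k * c k.+1.
  rewrite big_ord_recl expr0 mul1r mulr_sumr; congr (_ + _).
  by apply: eq_bigr => k _; rewrite mulrA -exprS.
have c0 : c 0%N = 0.
  have c0t t : 0 < t -> t <= 1 -> `|c 0%N| <= D * t.
    move=> t0 t1; have t0' := ltW t0; have := Hc t t0 t1; rewrite split => h.
    rewrite -(addrK (t * \sum_(k < n) t ^+ k * c k.+1) (c 0%N)).
    rewrite (le_trans (ler_normB _ _))// /D [leRHS]mulrDl lerD//.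
      rewrite (le_trans h)// ler_wpM2l// exprS ler_piMr// exprn_ile1//.
    rewrite normrM (ger0_norm t0') mulrC ler_wpM2r// (le_trans (ler_norm_sum _ _ _))//.
    apply: ler_sum => k _; rewrite normrM ler_piMl// normrX ger0_norm//.
    by rewrite exprn_ile1.
  apply/eqP/negPn/negP => cn0; have cp : 0 < `|c 0%N| by rewrite normr_gt0.
  pose X := D + `|c 0%N| + 1.
  have X0 : 0 < X by rewrite ltr_wpDl// addr_ge0.
  have X1 : `|c 0%N| / X <= 1.
    by rewrite ler_pdivrMr// mul1r /X addrAC lerDr addr_ge0.
  have := c0t (`|c 0%N| / X) (divr_gt0 cp X0) X1.
  rewrite mulrA ler_pdivlMr// [leLHS]mulrC ler_pM2r//; apply/negP.
  by rewrite -ltNge /X -addrA ltrDl ltr_wpDl.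
move=> [_|k kn]; first by [].
apply: (IH (fun k => c k.+1) C) => // t t0 t1.
have := Hc t t0 t1; rewrite split c0 add0r normrM (ger0_norm (ltW t0)).
by rewrite exprS mulrCA ler_pM2l.
Qed.

End Main.

Theorem theorem3p2 (R : realType) :
  exists (N : nat -> nat) (P : forall k : nat, @jet_poly R (N k)),
  forall (Phi : plane R -> plane R) (xi0 : plane R),
    let S := displacement Phi in
    smooth_map Phi ->
    fixed_points Phi = [set xi0] ->
    (exists p r C : R, [/\ 0 < p, 0 < r, 0 < C &
       forall x : plane R, r ^+ 2 / 2 < sigma x 0 ->
         C * (sigma x 0) `^ p <= S x]) ->
    nondegenerate_critical_point S xi0 ->
    (forall t : R, 0 < t -> deformed_heat_trace_exists Phi t) /\
    asymptotic_expansion (deformed_heat_trace Phi)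
      (fun k => laplace_coef (P k) S xi0).
Proof.
pose B K := projT1 (cid (@trace_expansion R K)).
exists (fun K => 2 * K.+2)%N, (fun k => B k k) => Phi xi S sPhi fPhi gS ndg; split.
  move=> t t0; have iE := displacement_integrable sPhi fPhi gS t0.
  exact: (integrableZl measurableT ((4 * pi * t)^-1) iE).
have HB K : exists2 C : R, 0 <= C & forall t, 0 < t -> t <= 1 ->
    `|deformed_heat_trace Phi t - \sum_(k < K.+1) t ^+ k * laplace_coef (B K k) S xi| <=
    C * t ^+ K.+1.
  exact: (projT2 (cid (@trace_expansion R K)) Phi xi sPhi fPhi gS ndg).
have BE K k : (k <= K)%N -> laplace_coef (B K k) S xi = laplace_coef (B k k) S xi.
  move=> kK; have [C C0 HC] := HB K; have [D D0 HD] := HB k.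
  pose E := D + C + \sum_(i < K - k) `|laplace_coef (B K (k.+1 + i)%N) S xi|.
  apply/eqP; rewrite -subr_eq0; apply/eqP.
  pose c i := laplace_coef (B K i) S xi - laplace_coef (B k i) S xi.
  apply: (@coef_eq0 R k.+1 c E) => // t t0 t1; have t0' := ltW t0.
  have -> : \sum_(i < k.+1) t ^+ i * c i =
      (deformed_heat_trace Phi t - \sum_(i < k.+1) t ^+ i * laplace_coef (B k i) S xi) -
      (deformed_heat_trace Phi t - \sum_(i < K.+1) t ^+ i * laplace_coef (B K i) S xi) -
      \sum_(i < K - k) t ^+ (k.+1 + i) * laplace_coef (B K (k.+1 + i)%N) S xi.
    have -> : \sum_(i < K.+1) t ^+ i * laplace_coef (B K i) S xi =
       \sum_(i < k.+1) t ^+ i * laplace_coef (B K i) S xi +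
       \sum_(i < K - k) t ^+ (k.+1 + i) * laplace_coef (B K (k.+1 + i)%N) S xi.
      exact: (sum_ord_split (fun i => t ^+ i * laplace_coef (B K i) S xi) kK).
    have -> : \sum_(i < k.+1) t ^+ i * c i = \sum_(i < k.+1) t ^+ i * laplace_coef (B K i) S xi -
        \sum_(i < k.+1) t ^+ i * laplace_coef (B k i) S xi.
      by rewrite -sumrB; apply: eq_bigr => i _; rewrite -mulrBr.
    by ring.
  rewrite (le_trans (ler_normB _ _))// /E [leRHS]mulrDl lerD//.
    rewrite (le_trans (ler_normB _ _))// [leRHS]mulrDl lerD ?HD// (le_trans (HC t t0 t1))//.
    by rewrite ler_wpM2l// ler_wiXn2l.
  rewrite (le_trans (ler_norm_sum _ _ _))// mulr_suml; apply: ler_sum => i _.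
  rewrite normrM mulrC ler_wpM2l// normrX ger0_norm// ler_wiXn2l//.
  by rewrite leq_addr.
move=> K; apply/eqoP => e e0.
have [C C0 HC] := HB K.
near=> t.
have t0 : 0 < t by near: t; exact: nbhs_right_gt.
have t1 : t <= 1 by near: t; exact: nbhs_right_le.
have tC : t <= e / (C + 1) by near: t; apply: nbhs_right_le; rewrite divr_gt0// ltr_wpDl.
have -> : \sum_(k < K.+1) t ^+ k * laplace_coef (B k k) S xi =
    \sum_(k < K.+1) t ^+ k * laplace_coef (B K k) S xi.
  by apply: eq_bigr => k _; rewrite BE// -ltnS.
rewrite (le_trans (HC t t0 t1))// (ger0_norm (exprn_ge0 _ (ltW t0))).
rewrite exprS mulrA ler_wpM2r ?exprn_ge0 ?(ltW t0)//.
rewrite (@le_trans _ _ ((C + 1) * t))//; first by rewrite ler_wpM2r ?(ltW t0)// lerDl.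
by rewrite mulrC -ler_pdivlMr// ltr_wpDl.
Unshelve. all: by end_near.
Qed.
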